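(* Let $t$ be a positive integer and let $\epsilon>0$. There is a randomized algorithm that, given an instance of the $t$-Dimensional Even-Cut Problem with $n$ vertices and $m$ edges, will, with probability at least $1-\epsilon$, correctly compute the optimal value in $O(n^5 m)$ time.
   Context: The $t$-Dimensional Even-Cut Problem: an instance is a tuple $(G,\tau,\Sigma,\alpha)$ with $G$ a graph, $\tau:V(G)\to\mathrm{GF}(2)^t$, $\Sigma\subseteq E(G)$ and $\alpha\in\mathrm{GF}(2)^t$; the problem is to find the minimum size of a non-empty set $\delta_G(X)\triangle\Sigma'$ where $(\Sigma',\alpha')\in\{(\Sigma,\alpha),(\emptyset,0)\}$ and $X\subseteq V(G)$ with $\tau(X)=\alpha'$. Here $\tau(X)=\sum_{v\in X}\tau(v)$, $\delta_G(X)$ is the set of edges with exactly one end in $X$, and $\triangle$ is symmetric difference. The number of vertices is $|V(G)|=n$ and of edges $|E(G)|=m$. *)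

(* Defs.v *)
From HB Require Import structures.
From mathcomp Require Import all_boot all_order all_algebra.
From mathcomp Require Import reals.

Set Implicit Arguments.
Unset Strict Implicit.
Unset Printing Implicit Defensive.

Import Order.TTheory GRing.Theory Num.Theory.

(** * The t-dimensional even-cut problem *)

(* Finite graphs, with loops and parallel edges allowed. The order of the two
   ends of an edge carries no meaning. *)
Record graph := Graph {
  nv : nat;
  ne : nat;
  ends : 'I_ne -> 'I_nv * 'I_nv
}.

Record instance (t : nat) := Instance {
  gr :> graph;
  tau : 'I_(nv gr) -> 'rV['F_2]_t;
  sigma : {set 'I_(ne gr)};
  alpha : 'rV['F_2]_t
}.

Definition cut (G : graph) (X : {set 'I_(nv G)}) : {set 'I_(ne G)} :=
  [set e | ((ends e).1 \in X) (+) ((ends e).2 \in X)].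

Definition symdiff (T : finType) (A B : {set T}) : {set T} :=
  (A :\: B) :|: (B :\: A).

Section Problem.
Variables (t : nat) (I : instance t).

Definition tau_sum (X : {set 'I_(nv I)}) : 'rV['F_2]_t :=
  (\sum_(v in X) tau v)%R.

Definition feasible (F : {set 'I_(ne I)}) : bool :=
  (F != set0) &&
  has (fun q : {set 'I_(ne I)} * 'rV['F_2]_t =>
         [exists X : {set 'I_(nv I)},
            (tau_sum X == q.2) && (F == symdiff (cut X) q.1)])
      [:: (sigma I, alpha I); (set0, 0%R)].

(* [None] stands for the minimum of the empty set. *)
Definition is_optimal_value (r : option nat) : bool :=
  if r is Some k then
    [exists F, feasible F && (#|F| == k)] &&
    [forall F, feasible F ==> (k <= #|F|)]
  else [forall F, ~~ feasible F].

End Problem.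

(** * Randomized word RAM *)

(* A machine word is a natural number below the word bound [W]. The memory
   consists of arrays of words: [s a i] is cell [i] of array [a]. Array names
   are literals, so that a program uses only finitely many arrays; a scalar
   variable is an array of which only cell 0 is used. *)
Definition memory := nat -> nat -> nat.

Definition update (s : memory) (a i x : nat) : memory :=
  fun b j => if (b == a) && (j == i) then x else s b j.

Variant binop := BAdd | BSub | BMul | BDiv | BMod | BEq | BLt.

Inductive expr :=
  | Const of nat
  | Get of nat & expr                 (* Get a i : read cell i of array a *)
  | Op of binop & expr & expr.

Inductive cmd :=
  | Skip
  | Assign of nat & expr & expr       (* Assign a i e : a[i] := e *)
  | Random of nat & expr & expr       (* Random a i e : a[i] := uniformly
                                         distributed element of {0, ..., e} *)
  | Seq of cmd & cmd
  | If of expr & cmd & cmd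
  | While of expr & cmd.

Definition eval_op (o : binop) (x y : nat) : nat :=
  match o with
  | BAdd => x + y
  | BSub => x - y
  | BMul => x * y
  | BDiv => x %/ y
  | BMod => x %% y
  | BEq => x == y
  | BLt => x < y
  end.

Section Semantics.
Variable W : nat.

Fixpoint eval (s : memory) (e : expr) : nat :=
  match e with
  | Const k => k %% W
  | Get a i => s a (eval s i)
  | Op o e1 e2 => eval_op o (eval s e1) (eval s e2) %% W
  end.

(* The equally likely successors of a configuration whose memory is [s] and
   whose pending commands are [c :: K]. One step evaluates at most two
   expressions of the program. As these have bounded size for a fixed program,
   counting steps agrees with counting word operations up to a constant factor
   depending on the program only. *)
Definition step (c : cmd) (K : seq cmd) (s : memory) : seq (seq cmd * memory) :=
  match c with
  | Skip => [:: (K, s)]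
  | Assign a i e => [:: (K, update s a (eval s i) (eval s e))]
  | Random a i e =>
      [seq (K, update s a (eval s i) x) | x <- iota 0 (eval s e).+1]
  | Seq c1 c2 => [:: (c1 :: c2 :: K, s)]
  | If e c1 c2 => [:: ((if eval s e != 0 then c1 else c2) :: K, s)]
  | While e b => [:: (if eval s e != 0 then b :: c :: K else K, s)]
  end.

(* The probability that, started with pending commands [K] and memory [s], the
   machine halts within [T] steps in a memory satisfying [E]. *)
Fixpoint prob_halt (R : realType) (E : pred memory) (T : nat)
    (K : seq cmd) (s : memory) : R :=
  match K, T with
  | [::], _ => (E s)%:R%R
  | _ :: _, 0 => 0%R
  | c :: K', T'.+1 =>
      let S := step c K' s in
      ((\sum_(g <- S) prob_halt R E T' g.1 g.2) / (size S)%:R)%R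
  end.

End Semantics.

(** * Input and output conventions *)

Section Encoding.
Variables (t : nat) (I : instance t).

(* Array 0: n, m; array 1: the t coordinates of alpha; array 2: coordinate j of
   tau(v) in cell v * t + j; arrays 3 and 4: the two ends of each edge;
   array 5: the indicator of Sigma. All other cells contain 0. *)
Definition input_arrays : seq (seq nat) :=
  [:: [:: nv I; ne I];
      [seq nat_of_ord (alpha I 0%R j) | j <- enum 'I_t];
      [seq nat_of_ord (tau v 0%R j) | v <- enum 'I_(nv I), j <- enum 'I_t];
      [seq nat_of_ord (ends e).1 | e <- enum 'I_(ne I)];
      [seq nat_of_ord (ends e).2 | e <- enum 'I_(ne I)];
      [seq nat_of_bool (e \in sigma I) | e <- enum 'I_(ne I)]].

Definition input : memory :=
  fun a i => nth 0 (nth [::] input_arrays a) i.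

(* The output is read in cell 0 of array 6. Feasible sets are non-empty, so 0
   is free to signal that there is none. *)
Definition output (s : memory) : option nat :=
  if s 6 0 == 0 then None else Some (s 6 0).

(* Words have O(log(n + m)) bits. *)
Definition word_bound (c : nat) : nat := (nv I + ne I + 2) ^ c.

End Encoding.

(* [p] halts within [T] steps whatever the random choices are, and its output
   is the optimal value of [I] with probability at least [1 - eps]. *)
Definition solves_within (R : realType) (eps : R) (t : nat) (p : cmd)
    (c T : nat) (I : instance t) : Prop :=
  prob_halt (word_bound I c) R xpredT T [:: p] (input I) = 1%R /\
  (1 - eps <=
   prob_halt (word_bound I c) R (fun s => is_optimal_value I (output s))
     T [:: p] (input I))%R.

(* Main.v *)
(** Random contraction in the manner of Karger. A state of the algorithm is a
    labelling [r] of the vertices, whose classes are the contracted vertices,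
    and a bit [x v] for each vertex; it stands for the sets [F] cut out by an
    [X] that agrees with [x] up to complementing whole classes. Contracting an
    edge [e] merges two classes, after flipping one of them if needed, so that
    exactly the [F] avoiding [e] remain.

    Let [k] be the optimum. If two classes have the same tau-sum then their
    union is an even cut, so unless they form a component of their own, one of
    them has degree at least [k / 2]. As there are only [2 ^ t] values of tau,
    all but [2 ^ t.+1] of the [h] non-isolated classes have degree at least
    [k / 2], hence a random crossing edge lies in an optimal [F] with
    probability at most [4 / (h - 2 ^ t.+1)]. Contracting until [h] is bounded
    preserves an optimal [F] with probability of order [n ^ -4], and it is then
    found with constant probability by complementing random classes: the live
    ones are guessed, and the tau-sum, a linear map to a space with [2 ^ t]
    elements, hits the right value with probability at least [2 ^ -t].

    Repeating this [O(n ^ 4)] times gives the theorem, since a run makes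
    [min (n, 2 m)] rounds of [O(n + m)] steps each, in total [O(n m)]. *)

Require Import Defs.
From mathcomp Require Import all_boot all_order all_algebra.
From mathcomp Require Import reals.
From mathcomp Require Import boolp ring lra zify.

Set Implicit Arguments.
Unset Strict Implicit.
Unset Printing Implicit Defensive.

Import Order.TTheory GRing.Theory Num.Theory.

(** * A program logic for expected values *)

Section Calculus.
Variables (W : nat) (R : realType).
Local Notation ph := (prob_halt W R).

Lemma prob_halt_ge0 E T K s : (0 <= ph E T K s)%R.
Proof.
elim: T K s => [|T IH] [|c K] s /=; rewrite ?ler0n //.
by rewrite divr_ge0 ?ler0n // sumr_ge0.
Qed.

Lemma size_step_gt0 c K s : 0 < size (step W c K s).
Proof. by case: c => [|a i e|a i e|c1 c2|e c1 c2|e c] //=; rewrite size_map size_iota. Qed.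

Lemma prob_halt_le1 E T K s : (ph E T K s <= 1)%R.
Proof.
elim: T K s => [|T IH] [|c K] s /=; rewrite ?ler01 ?lern1 ?leq_b1 //.
rewrite ler_pdivrMr ?ltr0n ?size_step_gt0 // mul1r -sum1_size natr_sum.
by apply: ler_sum.
Qed.

Lemma prob_haltS E T K s : (ph E T K s <= ph E T.+1 K s)%R.
Proof.
elim: T K s => [|T IH] [|c K] s //; first exact: prob_halt_ge0.
have -> : ph E T.+1 (c :: K) s =
  ((\sum_(g <- step W c K s) ph E T g.1 g.2) / (size (step W c K s))%:R)%R by [].
have -> : ph E T.+2 (c :: K) s =
  ((\sum_(g <- step W c K s) ph E T.+1 g.1 g.2) / (size (step W c K s))%:R)%R by [].
by rewrite ler_wpM2r ?invr_ge0 ?ler0n // ler_sum.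
Qed.

Lemma prob_halt_mono E T T' K s : T <= T' -> (ph E T K s <= ph E T' K s)%R.
Proof.
move=> /subnK <-; elim: (T' - T) => // d IH.
by rewrite addSn (le_trans IH) ?prob_haltS.
Qed.

(* The expectation of [g] after running [c] from [s] is at least [v], where all
   outcomes satisfy [P] and take at most [T] steps; in continuation-passing
   style, so that no distribution on memories is needed. *)
Definition triple (s : memory) (c : cmd) (T : nat) (P : memory -> Prop)
    (g : memory -> R) (v : R) : Prop :=
  forall E T' K, (forall s', P s' -> (g s' <= ph E T' K s')%R) ->
    (v <= ph E (T + T') (c :: K) s)%R.

(** With constant functions only the postcondition and the time bound remain; quantifying over [v]
    lets the statement precede any [triple]. *)
Definition surely s c T P := forall v, triple s c T P (fun=> v) v.

Lemma triple_le s c T P g v T1 P1 g1 v1 :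
  triple s c T1 P1 g1 v1 -> T1 <= T -> (v <= v1)%R ->
  (forall s', P1 s' -> P s' /\ (g1 s' <= g s')%R) -> triple s c T P g v.
Proof.
move=> H le_T le_v imp E T' K HK.
apply: le_trans le_v _; apply: (le_trans (H E T' K _)).
  by move=> s' /imp [/HK le1 le2]; apply: le_trans le2 le1.
by apply: prob_halt_mono; rewrite leq_add2r.
Qed.

Lemma surely_le s c T P T1 P1 :
  surely s c T1 P1 -> T1 <= T -> (forall s', P1 s' -> P s') -> surely s c T P.
Proof.
by move=> H le_T imp v; apply: triple_le (H v) le_T (lexx _) _ => s' /imp.
Qed.

Lemma triple_skip s (P : memory -> Prop) g : P s -> triple s Skip 1 P g (g s).
Proof.
by move=> Ps E T' K HK; rewrite add1n /= big_seq1 divr1; apply: HK.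
Qed.

Lemma surely_skip s (P : memory -> Prop) : P s -> surely s Skip 1 P.
Proof. by move=> Ps v; apply: (triple_skip (g := fun=> v)). Qed.

Lemma triple_assign s (P : memory -> Prop) g a i e :
  P (update s a (eval W s i) (eval W s e)) ->
  triple s (Assign a i e) 1 P g (g (update s a (eval W s i) (eval W s e))).
Proof.
by move=> Ps E T' K HK; rewrite add1n /= big_seq1 divr1; apply: HK.
Qed.

Lemma surely_assign s (P : memory -> Prop) a i e :
  P (update s a (eval W s i) (eval W s e)) -> surely s (Assign a i e) 1 P.
Proof. by move=> Ps v; apply: (triple_assign (g := fun=> v)). Qed.

Lemma triple_random s (P : memory -> Prop) g a i e :
  (forall x, x <= eval W s e -> P (update s a (eval W s i) x)) ->
  triple s (Random a i e) 1 P g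
    ((\sum_(0 <= x < (eval W s e).+1) g (update s a (eval W s i) x)) /
       (eval W s e).+1%:R)%R.
Proof.
move=> Ps E T' K HK.
rewrite add1n /prob_halt -/prob_halt /step big_map size_map size_iota.
rewrite ler_wpM2r ?invr_ge0 ?ler0n // /index_iota subn0.
rewrite big_seq [X in (_ <= X)%R]big_seq; apply: ler_sum => x.
by rewrite mem_iota add0n ltnS => le_x; apply/HK/Ps.
Qed.

(** The law of total expectation: [g1] is what the intermediate memory is still worth. The
    additional step unfolds [Seq]. *)
Lemma triple_seq s c1 c2 T1 T2 P1 g1 P g v :
  triple s c1 T1 P1 g1 v -> (forall s', P1 s' -> triple s' c2 T2 P g (g1 s')) ->
  triple s (Seq c1 c2) (T1 + T2).+1 P g v.
Proof.
move=> H1 H2 E T' K HK; rewrite addSn /= big_seq1 divr1 -addnA.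
by apply: H1 => s' Ps'; apply: H2.
Qed.

Lemma triple_seql s c1 c2 T1 T2 P1 P g v :
  surely s c1 T1 P1 -> (forall s', P1 s' -> triple s' c2 T2 P g v) ->
  triple s (Seq c1 c2) (T1 + T2).+1 P g v.
Proof. by move=> H1; apply: triple_seq (H1 v). Qed.

Lemma surely_seq s c1 c2 T1 T2 P1 P :
  surely s c1 T1 P1 -> (forall s', P1 s' -> surely s' c2 T2 P) ->
  surely s (Seq c1 c2) (T1 + T2).+1 P.
Proof. by move=> H1 H2 v; apply: triple_seql H1 _ => s' /H2. Qed.

Lemma triple_if s e c1 c2 T P g v :
  triple s (if eval W s e != 0 then c1 else c2) T P g v ->
  triple s (If e c1 c2) T.+1 P g v.
Proof. by move=> H E T' K HK; rewrite addSn /= big_seq1 divr1; apply: H. Qed.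

Lemma surely_if s e c1 c2 T P :
  surely s (if eval W s e != 0 then c1 else c2) T P -> surely s (If e c1 c2) T.+1 P.
Proof. by move=> H v; apply: triple_if. Qed.

Lemma triple_while0 s e c (P : memory -> Prop) g :
  eval W s e = 0 -> P s -> triple s (While e c) 1 P g (g s).
Proof.
by move=> e0 Ps E T' K HK; rewrite add1n /= e0 big_seq1 divr1; apply: HK.
Qed.

Lemma triple_whileS s e c T1 T2 P1 g1 P g v :
  eval W s e != 0 -> triple s c T1 P1 g1 v ->
  (forall s', P1 s' -> triple s' (While e c) T2 P g (g1 s')) ->
  triple s (While e c) (T1 + T2).+1 P g v.
Proof.
move=> e0 H1 H2 E T' K HK; rewrite addSn /= e0 big_seq1 divr1 -addnA.
by apply: H1 => s' Ps'; apply: H2.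
Qed.

(** * Counting loops *)

Definition var a := Get a (Const 0).

Definition For x e c :=
  Seq (Assign x (Const 0) (Const 0))
      (While (Op BLt (var x) e)
             (Seq c (Assign x (Const 0) (Op BAdd (var x) (Const 1))))).

(** [g k] is a potential that the body must not decrease on average. The 3 per round pays for the
    guard, the inner [Seq] and the increment; the other 3 for the outer [Seq], the initialization
    and the last guard. *)
Lemma triple_for s x e c N T (J : nat -> memory -> Prop) (g : nat -> memory -> R) P :
  1 < W -> N < W ->
  J 0 (update s x 0 0) ->
  (forall k s, k <= N -> J k s -> eval W s e = N /\ s x 0 = k) ->
  (forall k s, k < N -> J k s ->
     triple s c T
       (fun s' => s' x 0 = k /\ J k.+1 (update s' x 0 k.+1))
       (fun s' => g k.+1 (update s' x 0 k.+1)) (g k s)) ->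
  (forall s, J N s -> P s) ->
  triple s (For x e c) (N * (T + 3) + 3) P (g N) (g 0 (update s x 0 0)).
Proof.
move=> W1 NW J0 Jx body JP.
have -> : N * (T + 3) + 3 = (1 + (N * (T + 3) + 1)).+1 by rewrite add1n -addnS addn2 addn3.
apply: (@triple_seq _ _ _ _ _ (J 0) (g 0)).
  have := @triple_assign s (J 0) (g 0) x (Const 0) (Const 0).
  by rewrite /= mod0n; apply.
(* The induction is on the number [d] of rounds still to come. *)
have loop d : d <= N -> forall s, J (N - d) s -> triple s
    (While (Op BLt (var x) e)
       (Seq c (Assign x (Const 0) (Op BAdd (var x) (Const 1)))))
    (d * (T + 3) + 1) P (g N) (g (N - d) s); last first.
  by move=> s'; have := loop N (leqnn N) s'; rewrite subnn.
elim: d => [_|d IH le_d] {J0} {}s.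
  rewrite subn0 mul0n add0n => JN.
  apply: triple_while0; last exact: JP.
  by have [eN xN] := Jx N s (leqnn _) JN; rewrite /= eN mod0n xN ltnn mod0n.
move=> Jd; have lt_k : N - d.+1 < N by lia.
have [eN xk] := Jx _ _ (ltnW lt_k) Jd.
have -> : d.+1 * (T + 3) + 1 = (((T + 1).+1) + (d * (T + 3) + 1)).+1 by lia.
have kS : N - d = (N - d.+1).+1 by lia.
apply: (@triple_whileS _ _ _ _ _ (J (N - d)) (g (N - d))).
- by rewrite /= eN mod0n xk lt_k modn_small.
- apply: triple_seq (body _ _ lt_k Jd) _ => s' [xk' Js'].
  have := @triple_assign s' (J (N - d)) (g (N - d)) x (Const 0)
            (Op BAdd (var x) (Const 1)).
  rewrite /= mod0n xk' (modn_small W1) addn1 modn_small -?kS //.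
    by rewrite -kS in Js'; apply.
  by apply: leq_ltn_trans NW; rewrite leq_subr.
- by move=> s' Js'; apply: IH => //; apply: ltnW.
Qed.

Lemma surely_for s x e c N T (J : nat -> memory -> Prop) (P : memory -> Prop) :
  1 < W -> N < W ->
  J 0 (update s x 0 0) ->
  (forall k s, k <= N -> J k s -> eval W s e = N /\ s x 0 = k) ->
  (forall k s, k < N -> J k s ->
     surely s c T (fun s' => s' x 0 = k /\ J k.+1 (update s' x 0 k.+1))) ->
  (forall s, J N s -> P s) ->
  surely s (For x e c) (N * (T + 3) + 3) P.
Proof.
move=> W1 NW J0 Jx body JP v.
apply: (triple_for (J := J) (g := fun _ _ => v)) => // k s' kN Js'.
exact: body.
Qed.

End Calculus.

(** * Contractions of the graph *)

Lemma addrr2 n (w : 'rV['F_2]_n) : (w + w = 0)%R.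
Proof. by apply/rowP => j; rewrite !mxE -mulr2n -mulr_natl (pchar_Fp_0 (p := 2)) ?mul0r. Qed.

Section Contraction.
Variables (t : nat) (I : instance t).
Local Notation V := 'I_(nv I).
Local Notation E := 'I_(ne I).
Implicit Types (b : bool) (F : {set E}) (e : E) (r : V -> V) (x : V -> bool).

(** A bit [b] names one of the two admissible pairs, so that the algorithm can guess it. *)
Definition side_sigma (b : bool) : {set E} := if b then sigma I else set0.
Definition side_alpha (b : bool) : 'rV['F_2]_t := if b then alpha I else 0%R.
Definition side_cut (b : bool) (X : {set V}) : {set E} :=
  symdiff (cut X) (side_sigma b).

Lemma in_side_cut b X e :
  (e \in side_cut b X) =
  ((ends e).1 \in X) (+) ((ends e).2 \in X) (+) (b && (e \in sigma I)).
Proof.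
rewrite /side_cut /symdiff /side_sigma !inE.
by case: b; rewrite ?inE; do 3!case: (_ \in _).
Qed.

Lemma feasibleP (F : {set E}) :
  reflect (F != set0 /\ exists b X, tau_sum X = side_alpha b /\ F = side_cut b X)
          (feasible F).
Proof.
apply: (iffP andP) => [[F0 /hasP /= [q]]|[F0 [b [X [tX FX]]]]]; last split => //.
  rewrite !inE => /orP [] /eqP -> /existsP [X /andP [/eqP tX /eqP FX]]; split => //.
    by exists true, X.
  by exists false, X.
by apply/hasP; exists (side_sigma b, side_alpha b);
  [case: (b); rewrite !inE eqxx ?orbT | apply/existsP; exists X; rewrite tX FX !eqxx].
Qed.

(** * Degrees of contracted vertices *)

Definition crossing (r : V -> V) : {set E} :=
  [set e | r (ends e).1 != r (ends e).2].
Definition star (r : V -> V) (l : V) : {set E} :=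
  [set e in crossing r | (l == r (ends e).1) || (l == r (ends e).2)].
Definition live (r : V -> V) : {set V} := [set l | star r l != set0].

(** Handshake count: a crossing edge lies in the stars of its two end labels only. *)
Lemma sum_star_le r : \sum_l #|star r l| <= 2 * #|crossing r|.
Proof.
under eq_bigr => l _ do rewrite -sum1dep_card big_mkcondr /=.
rewrite exchange_big mulnC -sum_nat_const; apply: leq_sum => e _ /=.
rewrite -big_mkcond sum1dep_card.
by apply: leq_trans (subset_leq_card (_ : _ \subset [set r (ends e).1; r (ends e).2])) _;
  [apply/subsetP => l; rewrite !inE | rewrite cards2; case: eqP].
Qed.

(** A star is the cut of one class, so degrees of contracted vertices are sizes of cuts. *)
Lemma in_star_preim r l e :
  (e \in star r l) = ((ends e).1 \in r @^-1: [set l]) (+) ((ends e).2 \in r @^-1: [set l]).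
Proof.
rewrite !inE [l == _]eq_sym [l == r (ends e).2]eq_sym.
case: (eqVneq (r (ends e).1) (r (ends e).2)) => [->|]; first by rewrite addbb.
case: (eqVneq (r (ends e).1) l) => [->|] /=; first by case: eqVneq.
by case: eqP.
Qed.

Section Optimum.
Variable k : nat.
Hypothesis k_min : forall F : {set E}, feasible F -> k <= #|F|.

Definition low (r : V -> V) : {set V} := [set l in live r | 2 * #|star r l| < k].

(* Two low classes with equal tau-sum form an even cut smaller than [k], which
   must be empty: all crossing edges of one lead to the other. *)
Lemma low_pair r l1 l2 e : l1 \in low r -> l2 \in low r -> l1 != l2 ->
  tau_sum (r @^-1: [set l1]) = tau_sum (r @^-1: [set l2]) ->
  e \in star r l1 -> e \in star r l2.
Proof.
move=> l1P l2P ne12 eq_tau e1.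
have low1 : 2 * #|star r l1| < k by move: l1P; rewrite inE => /andP [].
have low2 : 2 * #|star r l2| < k by move: l2P; rewrite inE => /andP [].
pose X := r @^-1: [set l1; l2].
have dis : [disjoint r @^-1: [set l1] & r @^-1: [set l2]].
  apply/pred0P => v /=; rewrite !inE; apply/andP => -[/eqP -> /eqP e12].
  by rewrite e12 eqxx in ne12.
have XU : X = r @^-1: [set l1] :|: r @^-1: [set l2] by rewrite -preimsetU.
have inX v : (v \in X) = (v \in r @^-1: [set l1]) (+) (v \in r @^-1: [set l2]).
  by rewrite XU in_setU; have := disjointFr dis (x := v); case: (v \in _) => // ->.
have cutE f : (f \in side_cut false X) = (f \in star r l1) (+) (f \in star r l2).
  rewrite in_side_cut /= addbF !in_star_preim !inX.
  by do 4!case: (_ \in _).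
have tauX : tau_sum X = 0%R.
  have -> : tau_sum X = (tau_sum (r @^-1: [set l1]) + tau_sum (r @^-1: [set l2]))%R.
    by rewrite /tau_sum XU -bigU //; apply: eq_bigl => v; rewrite in_setU.
  by rewrite eq_tau addrr2.
have small : #|side_cut false X| < k.
  have : #|side_cut false X| <= #|star r l1| + #|star r l2|.
    rewrite -cardsUI (leq_trans _ (leq_addr _ _)) // subset_leq_card //.
    by apply/subsetP => f; rewrite cutE in_setU; do 2!case: (_ \in _).
  by lia.
case: (boolP (feasible (side_cut false X))) => [/k_min|]; first by rewrite leqNgt small.
move=> /feasibleP nf; have cut0 : side_cut false X = set0.
  apply/eqP/negPn/negP => n0; apply: nf; split => //; by exists false, X.
by have := cutE e; rewrite cut0 inE e1; case: (e \in _).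
Qed.

(** For each of the [2 ^ t] tau-sums there are at most two low labels: by [low_pair], three of them
    would share a crossing edge, which has only two ends. *)
Lemma card_low r : #|low r| <= 2 ^ t.+1.
Proof.
pose f l := tau_sum (r @^-1: [set l]).
have -> : #|low r| = \sum_(w : 'rV['F_2]_t) #|[set l in low r | f l == w]|.
  rewrite -sum1_card (partition_big f xpredT) //=.
  by apply: eq_bigr => w _; rewrite sum1dep_card.
rewrite expnS mulnC.
have <- : #|{: 'rV['F_2]_t}| = 2 ^ t by rewrite card_mx card_Fp // mul1n.
rewrite -sum_nat_const; apply: leq_sum => w _; rewrite leqNgt; apply/negP.
move=> /card_gt2P [l1 [l2 [l3 [[]]]]].
move=> /setIdP [low1 /eqP f1] /setIdP [low2 /eqP f2] /setIdP [low3 /eqP f3] [n12 n23 n31].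
have /set0Pn [e e1] : star r l1 != set0 by move: low1; rewrite !inE => /andP [].
have e2 : e \in star r l2 by apply: low_pair low1 low2 n12 _ e1; rewrite -/(f _) f1.
have e3 : e \in star r l3.
  by apply: low_pair low1 low3 _ _ e1; rewrite 1?eq_sym // -/(f _) f1.
move: e1 e2 e3; rewrite !inE => /andP [_ o1] /andP [_ o2] /andP [_ o3].
move: n12 n23 n31.
by case/orP: o1 => /eqP ->; case/orP: o2 => /eqP ->; case/orP: o3 => /eqP ->; rewrite eqxx.
Qed.

(** Live labels that are not low have degree at least [k / 2], and the degrees are summed by
    [sum_star_le]. The additive form avoids truncated subtraction. *)
Lemma crossing_lower_bound r : k * #|live r| <= 4 * #|crossing r| + k * 2 ^ t.+1.
Proof.
have sub : low r \subset live r by apply/subsetP => l; rewrite inE => /andP [].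
rewrite -(cardsID (low r) (live r)) (setIidPr sub) mulnDr addnC leq_add //; last first.
  by rewrite leq_mul2l card_low orbT.
(* One factor 2 comes from the threshold [k / 2], the other from the handshake count. *)
have -> : 4 = 2 * 2 by []; rewrite -mulnA mulnC -sum_nat_const.
apply: leq_trans (leq_mul (leqnn 2) (sum_star_le r)); rewrite big_distrr /=.
apply: leq_trans (_ : \sum_(l in live r :\: low r) 2 * #|star r l| <= _).
  apply: leq_sum => l; rewrite !inE negb_and => /andP [/orP [/negPf ->|] //].
  by rewrite -leqNgt.
by rewrite [leqRHS](bigID (mem (live r :\: low r))) leq_addr.
Qed.

End Optimum.

(** * Sets that survive shifts and merges *)

Lemma in_symdiff (T : finType) (A B : {set T}) a :
  (a \in symdiff A B) = (a \in A) (+) (a \in B).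
Proof. by rewrite !inE; do 2!case: (_ \in _). Qed.

Lemma tau_sum_addb (x y : V -> bool) :
  tau_sum [set v | x v (+) y v] =
    (tau_sum [set v | x v] + tau_sum [set v | y v])%R.
Proof.
rewrite /tau_sum 3!(eq_bigl _ _ (fun v => in_set _ v)).
rewrite [LHS]big_mkcond [X in (X + _)%R]big_mkcond [X in (_ + X)%R]big_mkcond -big_split.
apply: eq_bigr => v _ /=.
by case: (x v); case: (y v); rewrite /= ?addr0 ?add0r ?addrr2.
Qed.

(** The class of the second end is absorbed by that of the first. Its bits are flipped exactly if
    [e] is in the cut of the present bits, so that for crossing [e] no later complementation of
    classes cuts [e]. *)
Definition merge_label (r : V -> V) (e : E) (w : V) : V :=
  if r w == r (ends e).2 then r (ends e).1 else r w.
Definition merge_bit (b : bool) (r : V -> V) (x : V -> bool) (e : E) (w : V) : bool :=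
  x w (+) ((r w == r (ends e).2) &&
    (x (ends e).1 (+) x (ends e).2 (+) (b && (e \in sigma I)))).

(* [F] is one of the sets that survive in the contraction described by [r] and
   [x]: the vertices with the same label [l] are moved together, by [z l]. *)
Definition reachable (b : bool) (r : V -> V) (x : V -> bool) (F : {set E}) : Prop :=
  exists z : {set V}, let X := [set v | x v (+) (r v \in z)] in
    tau_sum X = side_alpha b /\ F = side_cut b X.

(** Adding [y] to the witness undoes the complementation by [y]; hence the random shift before a
    check loses no set. *)
Lemma reachable_shift b r x F (y : V -> bool) :
  reachable b r x F -> reachable b r (fun v => x v (+) y (r v)) F.
Proof.
move=> [z [tz ->]]; exists [set l | y l (+) (l \in z)].
suff -> : [set v | x v (+) y (r v) (+) (r v \in [set l | y l (+) (l \in z)])] =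
          [set v | x v (+) (r v \in z)] by [].
by apply/setP => v; rewrite !inE -addbA (addbA (y _)) addbb addFb.
Qed.

(** The same [z] works: as [e] is outside [F], the flip applied to the absorbed class equals the
    difference of [z] on the two end labels. *)
Lemma reachable_merge b r x F e : e \notin F ->
  reachable b r x F -> reachable b (merge_label r e) (merge_bit b r x e) F.
Proof.
move=> eF [z [tz FE]]; exists z.
suff -> : [set v | merge_bit b r x e v (+) (merge_label r e v \in z)] =
          [set v | x v (+) (r v \in z)] by [].
move: eF; rewrite FE in_side_cut !inE => eF.
apply/setP => v; rewrite !inE /merge_bit /merge_label.
case: eqP => [->|_] /=; last by rewrite addbF.
move: eF; do 2!case: (_ \in z); case: (_ && _); case: (x (ends e).1); case: (x (ends e).2);
  by case: (x v).
Qed.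

Lemma liveP r l : reflect (exists2 e, e \in crossing r & (l == r (ends e).1) || (l == r (ends e).2))
  (l \in live r).
Proof.
apply: (iffP idP) => [|[e e1 e2]]; rewrite [l \in _]in_set.
  by case/set0Pn => e /setIdP [e1 e2]; exists e.
by apply/set0Pn; exists e; apply/setIdP.
Qed.

(** The label of the second end disappears and no label becomes live. Further labels may die along
    with it. *)
Lemma card_live_merge r e : e \in crossing r ->
  #|live (merge_label r e)| < #|live r|.
Proof.
move=> eD; have live1 : r (ends e).1 \in live r by apply/liveP; exists e; rewrite ?eqxx.
have live2 : r (ends e).2 \in live r by apply/liveP; exists e; rewrite ?eqxx ?orbT.
have ne12 : r (ends e).1 != r (ends e).2 by move: eD; rewrite inE.
rewrite [X in _ < X](cardsD1 (r (ends e).2)) live2 add1n ltnS subset_leq_card //.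
apply/subsetP => l /liveP [f fD lf].
have fD' : f \in crossing r.
  move: fD; rewrite !inE /merge_label => neq.
  by apply/eqP => eq; rewrite eq eqxx in neq.
have [liv1 liv2] : r (ends f).1 \in live r /\ r (ends f).2 \in live r.
  by split; apply/liveP; exists f; rewrite ?eqxx ?orbT.
rewrite in_setD1.
by case/orP: lf => /eqP ->; rewrite /merge_label; case: ifP => [_|/negbT ->] //; rewrite ne12.
Qed.

(** Live labels have degree at least 1, whence the bound by [2 * ne I]; it keeps the number of
    rounds small when there are few edges. *)
Lemma card_live_le r : #|live r| <= minn (nv I) (2 * ne I).
Proof.
rewrite leq_min; apply/andP; split; first by rewrite -[X in _ <= X]card_ord max_card.
apply: leq_trans (_ : 2 * #|crossing r| <= _); last first.
  by rewrite leq_mul2l /= -[X in _ <= X]card_ord max_card.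
apply: leq_trans (sum_star_le r).
rewrite -sum1_card [leqRHS](bigID (mem (live r))) /= (leq_trans _ (leq_addr _ _)) //.
by apply: leq_sum => l; rewrite in_set card_gt0.
Qed.

(* A uniformly random set of labels restricts to a given set on the live labels
   and has a given attainable tau-sum with probability at least
   [2 ^- (#|live r| + t)]: the fibres of a linear map have the same size. *)
Lemma card_hits b r x F : reachable b r x F ->
  2 ^ nv I <= 2 ^ (#|live r| + t) *
    #|[set Y : {set V} |
        let X := [set v | x v (+) (r v \in Y)] in
        (tau_sum X == side_alpha b) && (side_cut b X == F)]|.
Proof.
move=> [z [tz FE]]; set good := [set Y | _].
(* The map whose fibres are counted: sets in one fibre differ only in labels that are not live, and
   select vertex sets of equal tau-sum. *)
pose f (Y : {set V}) := (Y :&: live r, tau_sum (r @^-1: Y)).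
have fA Y1 Y2 : f Y1 = f Y2 -> symdiff Y1 Y2 :&: live r = set0 /\
    tau_sum (r @^-1: symdiff Y1 Y2) = 0%R.
  move=> [/setP e1 e2]; split.
    apply/setP => l; move: (e1 l); rewrite !in_setI in_symdiff in_set0.
    by do 3!case: (_ \in _).
  have -> : r @^-1: symdiff Y1 Y2 =
      [set v | (r v \in Y1) (+) (r v \in Y2)].
    by apply/setP => v; rewrite !inE; do 2!case: (_ \in _).
  by rewrite tau_sum_addb -[X in (X + _)%R]/(tau_sum (r @^-1: Y1)) e2 addrr2.
(* Adding a difference within a fibre to the witness [z] changes neither the tau-sum nor the cut. *)
have goodA Y1 Y2 : f Y1 = f Y2 -> symdiff z (symdiff Y1 Y2) \in good.
  move=> /fA []; move: (symdiff Y1 Y2) => U l0 t0.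
  have U0 l : l \in live r -> l \in U = false.
    by move=> ll; move/setP/(_ l): l0; rewrite in_setI ll andbT in_set0.
  rewrite in_set; have -> : [set v | x v (+) (r v \in symdiff z U)] =
      [set v | (x v (+) (r v \in z)) (+) (r v \in U)].
    by apply/setP => v; rewrite !inE; do 2!case: (_ \in _); case: (x v).
  apply/andP; split.
    rewrite tau_sum_addb tz.
    by rewrite -[X in (_ + X)%R]/(tau_sum (r @^-1: U)) t0 addr0.
  rewrite FE; apply/eqP/setP => e; rewrite !in_side_cut !inE.
  case: (eqVneq (r (ends e).1) (r (ends e).2)) => [->|ne].
    by case: (_ \in U); case: (_ \in z); case: (x _); case: (x _); case: (_ && _).
  rewrite !U0 ?addbF //; apply/liveP; exists e; by rewrite ?inE ?eqxx ?orbT.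
have -> : 2 ^ nv I = #|{: {set V}}| by rewrite -cardsT -powersetT card_powerset cardsT card_ord.
rewrite -[X in X <= _]sum1_card (partition_big f (mem (setX (powerset (live r)) [set: 'rV['F_2]_t]))) /=;
  last by move=> Y _; rewrite !inE subsetIr.
have -> : 2 ^ (#|live r| + t) = #|setX (powerset (live r)) [set: 'rV['F_2]_t]|.
  by rewrite cardsX card_powerset cardsT card_mx card_Fp // mul1n expnD.
rewrite -sum_nat_const; apply: leq_sum => w _; rewrite sum1dep_card.
case: (set_0Vmem [set Y | f Y == w]) => [->|[Y0]]; first by rewrite cards0.
rewrite inE => /eqP f0.
(* A non-empty fibre is translated injectively into [good]. *)
rewrite -(card_in_imset (f := fun Y => symdiff z (symdiff Y Y0))); last first.
  move=> Y1 Y2 _ _ /setP eq; apply/setP => v; move: (eq v); rewrite !in_symdiff.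
  by do 4!case: (_ \in _).
apply: subset_leq_card; apply/subsetP => U /imsetP [Y]; rewrite inE => /eqP fY ->.
by apply: goodA; rewrite fY f0.
Qed.

End Contraction.

(** * The success probability of one run *)

Section RunProbability.
Variables (R : realType) (t : nat).

(** A check is credited only for at most [2 ^ t.+1 + 4] live labels; the last [t] in the exponent is
    the price of the tau-sum in [card_hits]. *)
Definition check_prob : R := ((2 ^ (2 ^ t.+1 + 4 + t))%:R^-1)%R.
(* The factor ['C(_, 4)] comes from the telescoping product of [1 - 4 / i]. *)
Definition run_prob (h : nat) : R :=
  (check_prob / ('C(maxn (h - 2 ^ t.+1) 4, 4))%:R)%R.

Lemma check_prob_gt0 : (0 < check_prob)%R.
Proof. by rewrite invr_gt0 ltr0n expn_gt0. Qed.

Lemma bin_max_gt0 h : 0 < 'C(maxn h 4, 4).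
Proof. by rewrite bin_gt0 leq_maxr. Qed.

Lemma run_prob_ge0 h : (0 <= run_prob h)%R.
Proof. by rewrite divr_ge0 ?ler0n // (ltW check_prob_gt0). Qed.

Lemma run_prob_anti h h' : h' <= h -> (run_prob h <= run_prob h')%R.
Proof.
move=> le_h; rewrite (ler_wpM2l (ltW check_prob_gt0)) // lef_pV2 ?posrE ?ltr0n ?bin_max_gt0 //.
by rewrite ler_nat leq_bin2l //; lia.
Qed.

Lemma run_prob_small h : h <= 2 ^ t.+1 + 4 -> run_prob h = check_prob.
Proof. by move=> le_h; rewrite /run_prob (_ : maxn _ _ = 4) ?binn ?divr1 //; lia. Qed.

(** With [d] crossing edges, at most [k] of them fatal, [F] survives with probability at least
    [1 - k / d], hence at least [1 - 4 / i] for [i = h - 2 ^ t.+1]. This is the quotient of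
    ['C(i.-1, 4)] by ['C(i, 4)]. *)
Lemma run_prob_step h k d : 2 ^ t.+1 + 4 < h -> k * h <= 4 * d + k * 2 ^ t.+1 ->
  (run_prob h * d%:R <= run_prob h.-1 * (d%:R - k%:R))%R.
Proof.
move=> lt_h le_k; rewrite /run_prob.
(* Writing [i] as [i4 + 5] keeps all differences free of truncation. *)
have [i4 [-> -> ki]] : exists i4, [/\ maxn (h - 2 ^ t.+1) 4 = i4.+4.+1,
  maxn (h.-1 - 2 ^ t.+1) 4 = i4.+4 & k * i4.+4.+1 <= 4 * d].
  exists (h - 2 ^ t.+1 - 5); move: (2 ^ t.+1) lt_h le_k => c lt_h le_k.
  have -> : (h - c - 5).+4.+1 = h - c by lia.
  split; [lia | lia | rewrite mulnBr; lia].
have := mul_bin_down i4.+4.+1 4; rewrite /= (_ : i4.+4.+1 - 4 = i4.+1); last by lia.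
have b1 : 0 < 'C(i4.+4, 4) by rewrite bin_gt0.
have b2 : 0 < 'C(i4.+4.+1, 4) by rewrite bin_gt0.
move: 'C(_, 4) 'C(i4.+4, 4) b1 b2 => x y y0 x0 e.
rewrite -!mulrA (ler_wpM2l (ltW check_prob_gt0)) //.
have x0R : (0 < x%:R :> R)%R by rewrite ltr0n.
have y0R : (0 < y%:R :> R)%R by rewrite ltr0n.
(* The absorption identity for binomial coefficients, from [mul_bin_down]. *)
have eR : ((i4%:R + 5) * y%:R = (i4%:R + 1) * x%:R :> R)%R.
  by rewrite -natrD natr1 -!natrM; congr (_%:R)%R; move: e; nia.
have kR : (k%:R * (i4%:R + 5) <= 4 * d%:R :> R)%R.
  by rewrite -natrD -!natrM ler_nat; lia.
have key : (0 <= (i4%:R + 5) * (x%:R * (d%:R - k%:R) - y%:R * d%:R) :> R)%R.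
  rewrite mulrBr [(_ * (y%:R * _))%R]mulrA eR.
  have -> : ((i4%:R + 5) * (x%:R * (d%:R - k%:R)) - (i4%:R + 1) * x%:R * d%:R =
    x%:R * (4 * d%:R - k%:R * (i4%:R + 5)) :> R)%R by ring.
  by rewrite mulr_ge0 ?subr_ge0 // ltW.
have i5 : (0 < i4%:R + 5 :> R)%R by rewrite -natrD ltr0n addnC.
rewrite pmulr_rge0 // subr_ge0 in key.
by rewrite ler_pdivrMl // mulrCA ler_pdivlMl.
Qed.

Lemma run_prob_lower_bound n h : 0 < n -> h <= n ->
  (check_prob / (n ^ 4)%:R <= run_prob h)%R.
Proof.
move=> n0 le_h; rewrite (ler_wpM2l (ltW check_prob_gt0)) //.
rewrite lef_pV2 ?posrE ?ltr0n ?bin_max_gt0 ?expn_gt0 ?n0 // ler_nat.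
case: (leqP (h - 2 ^ t.+1) 4) => [le4|lt4].
  by rewrite binn expn_gt0 n0.
apply: leq_trans (_ : 'C(n, 4) <= _).
  by rewrite leq_bin2l //; lia.
apply: leq_trans (_ : 'C(n, 4) * 4`! <= _); first by rewrite leq_pmulr.
by rewrite bin_ffact !ffactnS ffactn0 !expnS expn0 !leq_mul //; lia.
Qed.

(** An elementary substitute for an exponential bound: [(1 - p) ^+ N * (1 + N%:R * p)] starts at 1
    and does not increase with [N]. *)
Lemma power_decay (p : R) N : (0 <= p <= 1)%R -> ((1 - p) ^+ N <= (1 + N%:R * p)^-1)%R.
Proof.
move=> /andP [p0 p1].
have pos : (0 < 1 + N%:R * p)%R by rewrite ltr_pwDl ?mulr_ge0.
rewrite -[(_^-1)%R]mul1r ler_pdivlMr //.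
elim: N {pos} => [|N IH]; first by rewrite mul0r addr0 mulr1.
apply: le_trans IH; rewrite exprSr -mulrA ler_wpM2l ?exprn_ge0 ?subr_ge0 //.
have -> : ((1 - p) * (1 + N.+1%:R * p) = 1 + N%:R * p - (N.+1%:R * (p * p)))%R.
  by rewrite -natr1; ring.
by rewrite gerBl !mulr_ge0.
Qed.

End RunProbability.

(** * The program *)

Section Evaluation.
Variables (W : nat) (s : memory).

Lemma eval_const k : k < W -> eval W s (Const k) = k.
Proof. exact: modn_small. Qed.

Lemma eval_get a e i x : eval W s e = i -> s a i = x -> eval W s (Get a e) = x.
Proof. by move=> /= -> ->. Qed.

Lemma eval_var a x : s a 0 = x -> eval W s (var a) = x.
Proof. by move=> /= <-; rewrite mod0n. Qed.

Lemma eval_op_small o e1 e2 x y : eval W s e1 = x -> eval W s e2 = y ->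
  eval_op o x y < W -> eval W s (Op o e1 e2) = eval_op o x y.
Proof. by move=> /= -> -> /modn_small. Qed.

Lemma eval_add e1 e2 x y : eval W s e1 = x -> eval W s e2 = y ->
  x + y < W -> eval W s (Op BAdd e1 e2) = x + y.
Proof. exact: (eval_op_small (o := BAdd)). Qed.

Lemma eval_sub e1 e2 x y : eval W s e1 = x -> eval W s e2 = y ->
  x < W -> eval W s (Op BSub e1 e2) = x - y.
Proof. by move=> h1 h2 xW; apply: (eval_op_small (o := BSub) h1 h2); apply: leq_ltn_trans (leq_subr _ _) xW. Qed.

Lemma eval_mul e1 e2 x y : eval W s e1 = x -> eval W s e2 = y ->
  x * y < W -> eval W s (Op BMul e1 e2) = x * y.
Proof. exact: (eval_op_small (o := BMul)). Qed.

Lemma eval_mod e1 e2 x y : eval W s e1 = x -> eval W s e2 = y ->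
  x < W -> eval W s (Op BMod e1 e2) = x %% y.
Proof. by move=> h1 h2 xW; apply: (eval_op_small (o := BMod) h1 h2); apply: leq_ltn_trans (leq_mod _ _) xW. Qed.

Lemma eval_eq e1 e2 x y : eval W s e1 = x -> eval W s e2 = y ->
  1 < W -> eval W s (Op BEq e1 e2) = (x == y).
Proof. by move=> h1 h2 W1; apply: (eval_op_small (o := BEq) h1 h2); apply: leq_ltn_trans (leq_b1 _) W1. Qed.

Lemma eval_lt e1 e2 x y : eval W s e1 = x -> eval W s e2 = y ->
  1 < W -> eval W s (Op BLt e1 e2) = (x < y).
Proof. by move=> h1 h2 W1; apply: (eval_op_small (o := BLt) h1 h2); apply: leq_ltn_trans (leq_b1 _) W1. Qed.

End Evaluation.

(* Leaves the absence of overflow as side conditions. *)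
Ltac ev :=
  lazymatch goal with
  | |- eval _ _ (Const _) = _ => apply: eval_const
  | |- eval _ _ (var _) = _ => apply: eval_var; first [eassumption | reflexivity | idtac]
  | |- eval _ _ (Get _ _) = _ =>
      eapply eval_get; [ev | first [eassumption | reflexivity | idtac]]
  | |- eval _ _ (Op BAdd _ _) = _ => eapply eval_add; [ev | ev | ]
  | |- eval _ _ (Op BSub _ _) = _ => eapply eval_sub; [ev | ev | ]
  | |- eval _ _ (Op BMul _ _) = _ => eapply eval_mul; [ev | ev | ]
  | |- eval _ _ (Op BMod _ _) = _ => eapply eval_mod; [ev | ev | ]
  | |- eval _ _ (Op BEq _ _) = _ => eapply eval_eq; [ev | ev | ]
  | |- eval _ _ (Op BLt _ _) = _ => eapply eval_lt; [ev | ev | ]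
  | _ => idtac
  end.

(** * The layout of the input *)

Section Input.
Variables (t : nat) (I : instance t).

Lemma nth_map_enum n (f : 'I_n -> nat) (i : 'I_n) : nth 0 [seq f j | j <- enum 'I_n] i = f i.
Proof. by rewrite (nth_map i) ?size_enum_ord // nth_ord_enum. Qed.

Lemma input_alpha (j : 'I_t) : input I 1 j = alpha I 0%R j.
Proof. by rewrite /input /= (nth_map_enum (fun j => nat_of_ord (alpha I 0%R j))). Qed.
Lemma input_end1 (e : 'I_(ne I)) : input I 3 e = (ends e).1.
Proof. by rewrite /input /= (nth_map_enum (fun e => nat_of_ord (ends e).1)). Qed.
Lemma input_end2 (e : 'I_(ne I)) : input I 4 e = (ends e).2.
Proof. by rewrite /input /= (nth_map_enum (fun e => nat_of_ord (ends e).2)). Qed.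
Lemma input_sigma (e : 'I_(ne I)) : input I 5 e = (e \in sigma I).
Proof. by rewrite /input /= (nth_map_enum (fun e => nat_of_bool (e \in sigma I))). Qed.
Lemma input_out i : input I 6 i = 0. Proof. by rewrite /input /= nth_nil. Qed.

(** The row-major layout of [tau], by induction on the rows, each of length [t]. *)
Lemma nth_allpairs_ord (T : Type) (f : T -> 'I_t -> nat) (vs : seq T) i (j : 'I_t) x0 :
  i < size vs ->
  nth 0 [seq f v j | v <- vs, j <- enum 'I_t] (i * t + j) = f (nth x0 vs i) j.
Proof.
elim: vs i => [//|v vs IH] [|i] lt_i /=; rewrite nth_cat size_map size_enum_ord.
  by rewrite mul0n ltn_ord nth_map_enum.
by rewrite mulSn -addnA ltnNge leq_addr /= addKn IH.
Qed.

Lemma input_tau (v : 'I_(nv I)) (j : 'I_t) : input I 2 (v * t + j) = tau v 0%R j.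
Proof.
rewrite /input /= (nth_allpairs_ord (fun v j => nat_of_ord (tau v 0%R j)) _ v) ?nth_ord_enum //.
by rewrite size_enum_ord.
Qed.

End Input.

(* Arrays 0 to 5 hold the input and are never written. *)
Local Notation best := 6.
Local Notation label := 7.
Local Notation bit := 8.
Local Notation coin := 9.
Local Notation pool := 10.
Local Notation run := 11.
Local Notation iter := 12.
Local Notation i1 := 13.
Local Notation i2 := 14.
Local Notation side := 15.
Local Notation parity := 16.
Local Notation acc := 17.
Local Notation cut_size := 18.
Local Notation pool_size := 19.
Local Notation pick := 20.
Local Notation label1 := 21.
Local Notation label2 := 22.
Local Notation flip := 23.

(** * The commands of the algorithm *)

Definition e_nv := Get 0 (Const 0).
Definition e_ne := Get 0 (Const 1).
Definition put x e := Assign x (Const 0) e.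

Definition toss_coins := For i1 e_nv (Random coin (var i1) (Const 1)).
(** Coins are attached to labels, so that a whole class is complemented at once. *)
Definition shift := For i1 e_nv
  (Assign bit (var i1)
     (Op BMod (Op BAdd (Get bit (var i1)) (Get coin (Get label (var i1)))) (Const 2))).
Definition test_parity (t : nat) :=
  Seq (put parity (Const 1))
  (For i1 (Const t)
     (Seq (put acc (Const 0))
     (Seq (For i2 e_nv
             (put acc (Op BMod (Op BAdd (var acc)
                (Op BMul (Get bit (var i2))
                   (Get 2 (Op BAdd (Op BMul (var i2) (Const t)) (var i1))))) (Const 2))))
          (If (Op BEq (var acc) (Op BMul (var side) (Get 1 (var i1))))
             Skip (put parity (Const 0)))))).
Definition e_end1 e := Get 3 e.
Definition e_end2 e := Get 4 e.
(** The indicator of [side_cut] at an edge, with exclusive or as addition modulo 2. *)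
Definition e_frustrated e :=
  Op BMod (Op BAdd (Op BAdd (Get bit (e_end1 e)) (Get bit (e_end2 e)))
                   (Op BMul (var side) (Get 5 e))) (Const 2).
Definition measure_cut :=
  Seq (put cut_size (Const 0))
  (For i1 e_ne (put cut_size (Op BAdd (var cut_size) (e_frustrated (var i1))))).
(** Products and sums of truth values act as conjunction and disjunction; 0 in [best] means that
    nothing has been found yet. *)
Definition record_best :=
  If (Op BMul (Op BMul (var parity) (Op BLt (Const 0) (var cut_size)))
              (Op BAdd (Op BEq (var best) (Const 0)) (Op BLt (var cut_size) (var best))))
     (put best (var cut_size)) Skip.
Definition list_crossing :=
  Seq (put pool_size (Const 0))
  (For i1 e_ne
     (If (Op BEq (Get label (e_end1 (var i1))) (Get label (e_end2 (var i1)))) Skip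
        (Seq (Assign pool (var pool_size) (var i1))
             (put pool_size (Op BAdd (var pool_size) (Const 1)))))).
(** The two labels and the flip are saved first, because the loop overwrites the cells from which
    they are computed. *)
Definition merge :=
  Seq (put label1 (Get label (e_end1 (var pick))))
  (Seq (put label2 (Get label (e_end2 (var pick))))
  (Seq (put flip (e_frustrated (var pick)))
  (For i1 e_nv
     (If (Op BEq (Get label (var i1)) (var label2))
        (Seq (Assign label (var i1) (var label1))
             (Assign bit (var i1) (Op BMod (Op BAdd (Get bit (var i1)) (var flip)) (Const 2))))
        Skip)))).
Definition contract :=
  If (var pool_size)
    (Seq (Random pick (Const 0) (Op BSub (var pool_size) (Const 1)))
    (Seq (put pick (Get pool (var pick))) merge))
    Skip.
Definition check (t : nat) :=
  Seq shift (Seq (test_parity t) (Seq measure_cut record_best)).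
Definition iteration (t : nat) :=
  Seq toss_coins (Seq (check t) (Seq list_crossing contract)).
Definition reset := For i1 e_nv
  (Seq (Assign label (var i1) (var i1)) (Assign bit (var i1) (Const 0))).
(* [n - (n - 2 m)] is the minimum of [n] and [2 m] under truncated subtraction. *)
Definition e_rounds := Op BSub e_nv (Op BSub e_nv (Op BAdd e_ne e_ne)).
Definition one_run (t : nat) :=
  Seq (Random side (Const 0) (Const 1)) (Seq reset (For iter e_rounds (iteration t))).
(** Without edges there is nothing to find, and the loop would exceed a time bound that is then
    constant. *)
Definition even_cut_program (t c : nat) :=
  If e_ne
    (For run (Op BMul (Op BMul (Op BMul (Op BMul (Const c) e_nv) e_nv) e_nv) e_nv) (one_run t))
    Skip.

(** * Effect and running time of each command *)

Section Specifications.
Variables (W : nat) (R : realType) (t : nat) (I : instance t).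
Local Notation n := (nv I).
Local Notation m := (ne I).
Local Notation V := 'I_n.
Local Notation E := 'I_m.
Hypothesis W_large : n * t + 2 * m + n + t + 24 < W.
Local Notation surely := (surely W R).

(** A frame condition: [A] lists the arrays that may have changed. *)
Definition same (A : seq nat) (s s' : memory) := forall a i, a \notin A -> s' a i = s a i.
Definition reads (s : memory) := forall a i, a < 6 -> s a i = input I a i.
Definition coded (s : memory) (r : V -> V) (x : V -> bool) :=
  forall v : V, s label v = r v /\ s bit v = x v.
Definition coins (s : memory) (Y : {set V}) := forall v : V, s coin v = (v \in Y).

Lemma nat_addb (a b : bool) : a (+) b = (a + b) %% 2 :> nat.
Proof. by case: a; case: b. Qed.

Lemma same_update A s s' a i x : a \in A -> same A s s' -> same A s (update s' a i x).
Proof.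
move=> aA ss b j bA; rewrite /update; case: eqP => [eq|_] /=; last exact: ss.
by rewrite -eq (negPf bA) in aA.
Qed.

Lemma same_trans A s1 s2 s3 : same A s1 s2 -> same A s2 s3 -> same A s1 s3.
Proof. by move=> h1 h2 a i aA; rewrite h2 ?h1. Qed.

Lemma same_sub A B s s' : all (mem B) A -> same A s s' -> same B s s'.
Proof. by move=> /allP AB ss a i aB; apply: ss; apply: contra aB => /AB. Qed.

Lemma same_reads A s s' : all (leq 6) A -> same A s s' -> reads s -> reads s'.
Proof.
move=> /allP A6 ss rs a i a6; rewrite ss ?rs //.
by apply/negP => /A6; rewrite leqNgt a6.
Qed.

Lemma same_coded A s s' r x : label \notin A -> bit \notin A -> same A s s' ->
  coded s r x -> coded s' r x.
Proof. by move=> lA bA ss cs v; rewrite !ss. Qed.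

Lemma eval_nv A s s' : all (leq 6) A -> reads s -> same A s s' -> eval W s' e_nv = n.
Proof. by move=> A6 rs ss; rewrite /e_nv /e_ne; ev; [lia | rewrite (same_reads A6 ss rs) ]. Qed.

Lemma eval_ne A s s' : all (leq 6) A -> reads s -> same A s s' -> eval W s' e_ne = m.
Proof. by move=> A6 rs ss; rewrite /e_nv /e_ne; ev; [lia | rewrite (same_reads A6 ss rs) ]. Qed.

Lemma shift_spec s r x Y : reads s -> coded s r x -> coins s Y ->
  surely s shift (n * (1 + 3) + 3)
    (fun s' => same [:: bit; i1] s s' /\ coded s' r (fun v => x v (+) (r v \in Y))).
Proof.
move=> rs cs ks.
apply: (surely_for (J := fun k s' => [/\ same [:: bit; i1] s s', s' i1 0 = k &
    forall v : V, s' bit v = if v < k then x v (+) (r v \in Y) else x v])).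
- by lia.
- by lia.
- split=> //; first exact: same_update.
  by move=> v; rewrite ltn0 /=; case: (cs v).
- move=> k s' _ [ss sk _]; split => //; exact: eval_nv ss.
- move=> k s' kn [ss sk sv]; pose v : V := Ordinal kn.
  have E1 : eval W s' (Op BMod (Op BAdd (Get bit (var i1)) (Get coin (Get label (var i1))))
      (Const 2)) = (x v (+) (r v \in Y)).
    have s1 : s' bit k = x v by have := sv v; rewrite /= ltnn.
    have s2 : s' label k = r v by rewrite ss //; case: (cs v).
    have s3 : s' coin (r v) = (r v \in Y) by rewrite ss.
    by rewrite nat_addb; ev; lia.
  apply: surely_assign; rewrite E1.
  have -> : eval W s' (var i1) = k by ev.
  split=> //; split => //; first by do 2!apply: same_update => //.
  move=> w; rewrite /update /= ltnS leq_eqVlt; case: eqP (sv w) => [eq _|_ ->] //=.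
  by rewrite (_ : w = v) //; apply: val_inj.
- move=> s' [ss _ sv]; split=> // v; rewrite sv ltn_ord ss //; by case: (cs v).
Qed.

(** The program adds the representatives 0 and 1 as natural numbers; the passage to the field
    commutes with the sum. *)
Lemma coord_tau_sum (x : V -> bool) (j : 'I_t) :
  tau_sum [set v | x v] 0%R j = (\sum_(v : V) x v * tau v 0%R j) %% 2 :> nat.
Proof.
have -> : tau_sum [set v | x v] 0%R j = (\sum_(v : V) x v * tau v 0%R j)%:R%R.
  rewrite /tau_sum summxE natr_sum big_mkcond; apply: eq_bigr => v _; rewrite inE.
  by case: (x v); rewrite ?mul1n ?mul0n // natr_Zp.
by rewrite val_Fp_nat.
Qed.

Lemma sum_ltnS N (f : 'I_N -> nat) (i : 'I_N) :
  \sum_(j < N | j < i.+1) f j = \sum_(j < N | j < i) f j + f i.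
Proof.
rewrite (bigD1 i) //= addnC; congr (_ + _); apply: eq_bigl => j.
by rewrite ltnS ltn_neqAle andbC.
Qed.

Lemma parity_spec s r x (b : bool) : reads s -> coded s r x -> s side 0 = b ->
  surely s (test_parity t) (t * (4 * n + 8 + 3) + 5)
    (fun s' => same [:: i1; i2; parity; acc] s s' /\
       s' parity 0 = (tau_sum [set v | x v] == side_alpha I b)).
Proof.
move=> rs cs sb; set X := [set v | x v]; set A := [:: _; _; _; _].
have -> : t * (4 * n + 8 + 3) + 5 = (1 + (t * (4 * n + 8 + 3) + 3)).+1 by lia.
pose good k := [forall j : 'I_t, (j < k) ==> (tau_sum X 0%R j == side_alpha I b 0%R j)].
apply: (surely_seq (P1 := fun s' => same A s s' /\ s' parity 0 = 1)).
  apply: surely_assign; rewrite eval_const; last lia; rewrite eval_const; last lia.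
  by split => //; apply: same_update.
move=> s1 [ss1 ev1].
apply: (surely_for (J := fun k s' => [/\ same A s s', s' i1 0 = k & s' parity 0 = good k])).
- by lia.
- by lia.
- split=> //; first exact: same_update.
  rewrite /update /= ev1 /good; case: forallP => // -[] j; by rewrite ltn0.
- by move=> k s' _ [ss sk _]; split => //; rewrite eval_const //; lia.
- move=> k s' kt [ss sk sg]; pose j : 'I_t := Ordinal kt.
  have -> : 4 * n + 8 = (1 + ((n * (1 + 3) + 3) + 2).+1).+1 by lia.
  apply: (surely_seq (P1 := fun s' =>
      [/\ same A s s', s' i1 0 = k, s' parity 0 = good k & s' acc 0 = 0])).
    apply: surely_assign; rewrite eval_const; last lia.
    by split => //; apply: same_update.
  move=> {sk sg ss} {}s' [ss sk sg s20].
  apply: (surely_seq (P1 := fun s' =>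
      [/\ same A s s', s' i1 0 = k, s' parity 0 = good k &
          s' acc 0 = tau_sum X 0%R j])).
    apply: (surely_for (J := fun l s' => [/\ same A s s', s' i1 0 = k, s' parity 0 = good k
         & s' i2 0 = l /\ s' acc 0 = (\sum_(v < n | v < l) x v * tau v 0%R j) %% 2])).
    + by lia.
    + by lia.
    + split => //; first exact: same_update.
      by rewrite /update /= big_pred0.
    + move=> l s2 _ [ss' _ _ [sl _]]; split => //; exact: eval_nv ss'.
    + move=> l s2 ln [ss2 sk' sg' [sl' sa']]; pose v : V := Ordinal ln.
      have E1 : eval W s2 (Op BMod (Op BAdd (var acc)
                (Op BMul (Get bit (var i2))
                   (Get 2 (Op BAdd (Op BMul (var i2) (Const t)) (var i1))))) (Const 2)) =
          (\sum_(v0 < n | v0 < l.+1) x v0 * tau v0 0%R j) %% 2.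
        have h1 : s2 bit l = x v by rewrite ss2 //; case: (cs v).
        have h2 : s2 2 (l * t + k) = tau v 0%R j by rewrite ss2 // rs // -(input_tau v j).
        rewrite (sum_ltnS (fun v0 => x v0 * tau v0 0%R j) v) -modnDml -/(nat_of_ord v).
        have : nat_of_ord (tau v 0%R j) < 2 by exact: ltn_ord.
        have : (\sum_(v0 < n | v0 < v) x v0 * tau v0 0%R j) %% 2 < 2 by rewrite ltn_mod.
        rewrite [nat_of_ord v]/= -sa'; move: (nat_of_ord (tau _ _ _)) h2 => w h2 lta ltw.
        ev; try lia; nia.
      apply: surely_assign; rewrite E1 eval_const; last lia.
      by split=> //; split => //; do 2!apply: same_update => //.
    + move=> s2 [ss2 sk' sg' [_ sa']]; split => //; rewrite sa' coord_tau_sum.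
      by congr (_ %% 2); apply: eq_bigl => v; rewrite ltn_ord.
  move=> {ss sk sg s20 s'} s3 [ss sk sg s3a].
  have E1 : eval W s3 (Op BEq (var acc) (Op BMul (var side) (Get 1 (var i1)))) =
     (tau_sum X 0%R j == side_alpha I b 0%R j).
    have h1 : s3 side 0 = b by rewrite ss.
    have h2 : s3 1 k = alpha I 0%R j by rewrite ss // rs // -(input_alpha I j).
    have -> : (tau_sum X 0%R j == side_alpha I b 0%R j) =
        (nat_of_ord (tau_sum X 0%R j) == b * alpha I 0%R j).
      rewrite -val_eqE /=; congr (_ == _).
      by rewrite /side_alpha; case: (b); rewrite ?mul1n ?mul0n ?mxE.
    have : nat_of_ord (alpha I 0%R j) < 2 by exact: ltn_ord.
    move: (nat_of_ord (alpha I 0%R j)) h2 => w h2 ltw.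
    by ev; try lia; nia.
  have goodS : good k.+1 = good k && (tau_sum X 0%R j == side_alpha I b 0%R j).
    apply/forallP/andP => [H|[/forallP H Hj] i].
      split; last by have := H j; rewrite ltnSn.
      by apply/forallP => i; apply/implyP => ik; have := H i; rewrite (ltnW ik : i < k.+1).
    apply/implyP; rewrite ltnS leq_eqVlt => /orP [/eqP ik|ik]; last exact: (implyP (H i)).
    by rewrite (_ : i = j) //; apply: val_inj.
  apply: surely_if; rewrite E1 eqb0 negbK.
  case: ifP goodS => _; rewrite ?andbT ?andbF => goodS.
    apply: surely_skip; split => //; split => //; first exact: same_update.
    by rewrite goodS.
  apply: surely_assign; rewrite eval_const; last lia.
  by split => //; split => //; [do 2!apply: same_update => // | rewrite goodS].
- move=> s' [ss _ ->]; split => //; congr nat_of_bool.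
  apply/forallP/eqP => [H|-> j]; last by rewrite eqxx implybT.
  by apply/rowP => j; have := H j; rewrite ltn_ord => /eqP.
Qed.

Lemma eval_frustrated s r x (b : bool) e (f : E) :
  reads s -> coded s r x -> s side 0 = b -> eval W s e = f ->
  eval W s (e_frustrated e) =
    (x (ends f).1 (+) x (ends f).2 (+) (b && (f \in sigma I))).
Proof.
move=> rs cs sb ef; rewrite /e_frustrated /e_end1 /e_end2.
have h1 : s 3 f = (ends f).1 by rewrite rs // input_end1.
have h2 : s 4 f = (ends f).2 by rewrite rs // input_end2.
have h3 : s 5 f = (f \in sigma I) by rewrite rs // input_sigma.
have [_ h4] := cs (ends f).1; have [_ h5] := cs (ends f).2.
rewrite !nat_addb modnDml -mulnb.
ev; try exact: ef; try lia; case: b {sb}; lia.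
Qed.

Lemma measure_spec s r x (b : bool) : reads s -> coded s r x -> s side 0 = b ->
  surely s measure_cut (m * (1 + 3) + 5)
    (fun s' => same [:: i1; cut_size] s s' /\ s' cut_size 0 = #|side_cut b [set v | x v]|).
Proof.
move=> rs cs sb; set A := [:: _; _]; set X := [set v | x v].
have -> : m * (1 + 3) + 5 = (1 + (m * (1 + 3) + 3)).+1 by lia.
apply: (surely_seq (P1 := fun s' => same A s s' /\ s' cut_size 0 = 0)).
  apply: surely_assign; rewrite eval_const; last lia.
  by split => //; apply: same_update.
move=> s1 [ss1 s10].
apply: (surely_for (J := fun k s' => [/\ same A s s', s' i1 0 = k &
    s' cut_size 0 = \sum_(e < m | e < k) (e \in side_cut b X)])).
- by lia.
- by lia.
- split=> //; first exact: same_update.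
  by rewrite /update /= s10 big_pred0.
- by move=> k s' _ [ss sk _]; split => //; exact: eval_ne ss.
- move=> k s' km [ss sk sv]; pose f : E := Ordinal km.
  have E1 : eval W s' (Op BAdd (var cut_size) (e_frustrated (var i1))) =
      \sum_(e < m | e < k.+1) (e \in side_cut b X).
    rewrite (sum_ltnS (fun e => nat_of_bool (e \in side_cut b X)) f) -sv.
    have cs' : coded s' r x by apply: same_coded ss cs.
    have rs' : reads s' by apply: same_reads ss rs.
    have sb' : s' side 0 = b by rewrite ss.
    (* Partial counts never exceed [m], so the counter does not overflow. *)
    have sz : s' cut_size 0 <= m.
      rewrite sv -[X in _ <= X]card_ord -sum1_card [leqRHS](bigID (fun e : E => e < k)) /=.
      by rewrite (leq_trans _ (leq_addr _ _)) // leq_sum // => e _; exact: leq_b1.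
    eapply eval_add; first by ev.
      rewrite (eval_frustrated (f := f) rs' cs' sb'); last by ev.
      by rewrite in_side_cut !inE.
    by lia.
  apply: surely_assign; rewrite E1 eval_const; last lia.
  by split=> //; split => //; do 2!apply: same_update => //.
- move=> s' [ss _ sv]; split=> //; rewrite sv -sum1_card [RHS]big_mkcond /=.
  apply: eq_big => [e|e _]; first exact: ltn_ord.
  by case: (_ \in _).
Qed.

Definition better (old new : nat) (ok : bool) :=
  if ok && (0 < new) && ((old == 0) || (new < old)) then new else old.

Lemma record_spec (s : memory) (ok : bool) : s parity 0 = ok ->
  surely s record_best 2
    (fun s' => same [:: best] s s' /\ s' best 0 = better (s best 0) (s cut_size 0) ok).
Proof.
move=> se; apply: surely_if.
have -> : eval W s (Op BMul (Op BMul (var parity) (Op BLt (Const 0) (var cut_size)))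
              (Op BAdd (Op BEq (var best) (Const 0)) (Op BLt (var cut_size) (var best)))) =
  ok * (0 < s cut_size 0) * ((s best 0 == 0) + (s cut_size 0 < s best 0)).
  by ev; try lia; case: ok {se}; lia.
rewrite muln_eq0 addn_eq0 muln_eq0 !eqb0 !negb_or negb_and !negbK /better.
case: ifP => _; last exact: surely_skip.
apply: surely_assign; rewrite eval_const; last lia; rewrite (eval_var _ (erefl _)).
by split => //; apply: same_update.
Qed.

Lemma list_spec s r x : reads s -> coded s r x ->
  surely s list_crossing (m * (4 + 3) + 5)
    (fun s' => [/\ same [:: pool; i1; pool_size] s s', s' pool_size 0 = #|crossing r| &
       forall i, i < #|crossing r| ->
         s' pool i = nth 0 [seq nat_of_ord e | e <- enum (crossing r)] i]).
Proof.
move=> rs cs; set A := [:: _; _; _].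
have -> : m * (4 + 3) + 5 = (1 + (m * (4 + 3) + 3)).+1 by lia.
apply: (surely_seq (P1 := fun s' => same A s s' /\ s' pool_size 0 = 0)).
  apply: surely_assign; rewrite eval_const; last lia.
  by split => //; apply: same_update.
move=> s1 [ss1 s10].
pose L k := [seq nat_of_ord e | e <- take k (enum 'I_m) & e \in crossing r].
apply: (surely_for (J := fun k s' => [/\ same A s s', s' i1 0 = k,
    s' pool_size 0 = size (L k) & forall i, i < size (L k) -> s' pool i = nth 0 (L k) i])).
- by lia.
- by lia.
- rewrite /L take0; split=> //; exact: same_update.
- by move=> k s' _ [ss sk _]; split => //; exact: eval_ne ss.
- move=> k s' km [ss sk sl sL]; pose f : E := Ordinal km.
  have rs' : reads s' by apply: same_reads ss rs.
  have cs' : coded s' r x by apply: same_coded ss cs.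
  have LS : L k.+1 = if f \in crossing r then rcons (L k) k else L k.
    rewrite /L (take_nth f) ?size_enum_ord // filter_rcons (nth_ord_enum f f).
    by case: (f \in _); rewrite ?map_rcons.
  apply: surely_if.
  have -> : eval W s' (Op BEq (Get label (e_end1 (var i1))) (Get label (e_end2 (var i1)))) =
      (f \notin crossing r).
    have h1 : s' 3 k = (ends f).1 by rewrite rs' // -(input_end1 f).
    have h2 : s' 4 k = (ends f).2 by rewrite rs' // -(input_end2 f).
    have [h3 _] := cs' (ends f).1; have [h4 _] := cs' (ends f).2.
    rewrite !inE negbK -val_eqE /e_end1 /e_end2.
    by ev; lia.
  have szL : size (L k) <= k.
    by rewrite size_map size_filter (leq_trans (count_size _ _)) // size_take; case: ifP; lia.
  rewrite eqb0 negbK; case: ifP LS => fD LS.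
    rewrite -[3]/(1 + 1).+1.
    apply: (surely_seq (P1 := fun s' => [/\ same A s s', s' i1 0 = k,
      s' pool_size 0 = size (L k) & forall i, i < size (L k.+1) -> s' pool i = nth 0 (L k.+1) i])).
      apply: surely_assign; rewrite (eval_var _ sl) (eval_var _ sk).
      split => //; first exact: same_update.
      move=> i; rewrite LS size_rcons ltnS leq_eqVlt nth_rcons /update /=.
      by case: eqP => [->|_] /=; [rewrite ltnn | move=> lt; rewrite lt sL].
    move=> {sk sl sL ss rs' cs'} {}s' [ss sk sl sL].
    apply: surely_assign; rewrite eval_const; last lia.
    have -> : eval W s' (Op BAdd (var pool_size) (Const 1)) = (size (L k)).+1 by rewrite -(addn1 (size _)); ev; lia.
    split => //; split => //; first by do 2!apply: same_update => //.
    by rewrite LS size_rcons.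
  apply: (@surely_le _ _ _ _ _ _ 1); [|by []|by move=> s'' H; exact: H].
  apply: surely_skip; split => //; split; rewrite ?LS //; exact: same_update.
- have -> : #|crossing r| = size (L m).
    by rewrite size_map take_oversize ?size_enum_ord // cardE /enum_mem -filter_predI; congr size; apply: eq_filter => e; rewrite /= andbT.
  move=> s' [ss _ sl sL]; split => // i lt_i; rewrite sL //.
  congr (nth 0 _ i); rewrite /L take_oversize ?size_enum_ord //; congr map.
  by rewrite {1}/enum_mem -filter_predI; apply: eq_filter => e; rewrite /= andbT.
Qed.

Lemma merge_spec s r x (b : bool) (f : E) :
  reads s -> coded s r x -> s side 0 = b -> s pick 0 = f ->
  surely s merge (n * (4 + 3) + 9)
    (fun s' => same [:: label; bit; i1; label1; label2; flip] s s' /\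
       coded s' (merge_label r f) (merge_bit b r x f)).
Proof.
move=> rs cs sb sp; set A := [:: _; _; _; _; _; _].
have -> : n * (4 + 3) + 9 = (1 + (1 + (1 + (n * (4 + 3) + 3)).+1).+1).+1 by lia.
have A6 : all (leq 6) A by [].
pose B := [:: label1; label2; flip].
apply: (surely_seq (P1 := fun s' => same B s s' /\ s' label1 0 = r (ends f).1)).
  apply: surely_assign; rewrite eval_const; last lia.
  have -> : eval W s (Get label (e_end1 (var pick))) = r (ends f).1.
    have h1 : s 3 f = (ends f).1 by rewrite rs // input_end1.
    have [h2 _] := cs (ends f).1.
    by rewrite /e_end1; ev.
  by split => //; apply: same_update.
move=> s1 [ss1 s1l].
apply: (surely_seq (P1 := fun s' => [/\ same B s s', s' label1 0 = r (ends f).1 &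
    s' label2 0 = r (ends f).2])).
  apply: surely_assign; rewrite eval_const; last lia.
  have -> : eval W s1 (Get label (e_end2 (var pick))) = r (ends f).2.
    have h1 : s1 4 f = (ends f).2 by rewrite ss1 // rs // input_end2.
    have [h2 _] := same_coded (A := B) isT isT ss1 cs (ends f).2.
    have h3 : s1 pick 0 = f by rewrite ss1.
    by rewrite /e_end2; ev.
  by split => //; apply: same_update.
move=> {ss1 s1l s1} s1 [ss1 l1 l2].
pose fl := x (ends f).1 (+) x (ends f).2 (+) (b && (f \in sigma I)).
apply: (surely_seq (P1 := fun s' => [/\ same B s s', s' label1 0 = r (ends f).1,
    s' label2 0 = r (ends f).2 & s' flip 0 = fl])).
  apply: surely_assign; rewrite eval_const; last lia.
  rewrite (eval_frustrated (f := f) (same_reads (A := B) isT ss1 rs) (same_coded (A := B) isT isT ss1 cs) (b := b)) //.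
  - by split => //; apply: same_update.
  - by rewrite ss1.
  - by ev; rewrite ss1.
move=> {ss1 l1 l2 s1} s1 [ss1 l1 l2 l3].
apply: (surely_for (J := fun k s' => [/\ same A s s', s' i1 0 = k,
   [/\ s' label1 0 = r (ends f).1, s' label2 0 = r (ends f).2 & s' flip 0 = fl],
   forall v : V, s' label v = if v < k then merge_label r f v else r v &
   forall v : V, s' bit v = if v < k then merge_bit b r x f v else x v])).
- by lia.
- by lia.
- split=> //; first by apply: same_update => //; exact: (same_sub (A := B)) ss1.
    by move=> v; rewrite ltn0 /update /= ss1 //; case: (cs v).
  by move=> v; rewrite ltn0 /update /= ss1 //; case: (cs v).
- by move=> k s' _ [ss sk _ _ _]; split => //; exact: eval_nv ss.
- move=> k s' kn [ss sk [sl1 sl2 sfl] sl sx]; pose v : V := Ordinal kn.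
  have slv : s' label k = r v by have := sl v; rewrite /= ltnn.
  have sxv : s' bit k = x v by have := sx v; rewrite /= ltnn.
  have step_if (T : Type) (g h : V -> T) (w : V) : (if w < k.+1 then g w else h w) =
      if w == v then g v else if w < k then g w else h w.
    by rewrite ltnS leq_eqVlt -val_eqE /=; case: eqP => [e|] //=; rewrite (_ : w = v) //; apply: val_inj.
  apply: surely_if.
  have -> : eval W s' (Op BEq (Get label (var i1)) (var label2)) = (r v == r (ends f).2).
    by rewrite -val_eqE; ev; lia.
  rewrite eqb0 negbK; case: ifP => same_label.
    rewrite -[3]/(1 + 1).+1.
    apply: (surely_seq (P1 := fun s'' => s'' = update s' label k (r (ends f).1))).
      by apply: surely_assign; rewrite (eval_var _ sk) (eval_var _ sl1).
    move=> _ ->; apply: surely_assign.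
    have -> : eval W (update s' label k (r (ends f).1))
        (Op BMod (Op BAdd (Get bit (var i1)) (var flip)) (Const 2)) = x v (+) fl.
      by rewrite nat_addb; ev; lia.
    have -> : eval W (update s' label k (r (ends f).1)) (var i1) = k by ev.
    split => //; split => //; first by do 3!apply: same_update => //.
      move=> w; rewrite step_if -val_eqE /update /= /merge_label -/v same_label.
      by case: eqP => // _; rewrite sl.
    move=> w; rewrite step_if -val_eqE /update /= /merge_bit same_label -/fl.
    by case: eqP => // _; rewrite sx.
  apply: (@surely_le _ _ _ _ _ _ 1); [|by []|by move=> s'' H; exact: H].
  apply: surely_skip; split => //; split => //; first exact: same_update.
    move=> w; rewrite step_if -val_eqE /update /= /merge_label -/v same_label.
    by case: eqP => [->|_] //; rewrite sl.
  move=> w; rewrite step_if -val_eqE /update /= /merge_bit same_label addbF.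
  by case: eqP => [->|_] //; rewrite sx.
- by move=> s' [ss _ _ sl sx]; split => // v; rewrite sl sx ltn_ord.
Qed.

Lemma reset_spec s : reads s ->
  surely s reset (n * (3 + 3) + 3)
    (fun s' => same [:: label; bit; i1] s s' /\ coded s' id xpred0).
Proof.
move=> rs; set A := [:: _; _; _].
apply: (surely_for (J := fun k s' => [/\ same A s s', s' i1 0 = k &
  forall v : V, v < k -> s' label v = v /\ s' bit v = false])).
- by lia.
- by lia.
- split=> //; exact: same_update.
- by move=> k s' _ [ss sk _]; split => //; exact: eval_nv ss.
- move=> k s' kn [ss sk sv].
  rewrite -[3]/(1 + 1).+1.
  apply: (surely_seq (P1 := fun s'' => s'' = update s' label k k)).
    by apply: surely_assign; rewrite (eval_var _ sk).
  move=> _ ->; apply: surely_assign.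
  rewrite eval_const; last lia.
  have -> : eval W (update s' label k k) (var i1) = k by ev.
  split=> //; split => //; first by do 3!apply: same_update => //.
  move=> v; rewrite ltnS leq_eqVlt /update /=; case: eqP => [-> //|_ /=] /sv [-> ->].
  by [].
- by move=> s' [ss _ sv]; split => // v; apply: sv.
Qed.

Definition check_time := n * (1 + 3) + t * (4 * n + 11) + m * (1 + 3) + 18.

Lemma check_spec s r x (b : bool) Y :
  reads s -> coded s r x -> s side 0 = b -> coins s Y ->
  let x' := fun v => x v (+) (r v \in Y) in let X := [set v | x' v] in
  surely s (check t) check_time
    (fun s' => [/\ same [:: best; bit; i1; i2; parity; acc; cut_size] s s', coded s' r x' &
       s' best 0 = better (s best 0) #|side_cut b X| (tau_sum X == side_alpha I b)]).
Proof.
move=> rs cs sb ks x' X; set A := [:: _; _; _; _; _; _; _].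
have -> : check_time = (n * (1 + 3) + 3 + ((t * (4 * n + 8 + 3) + 5) +
   ((m * (1 + 3) + 5) + 2).+1).+1).+1 by rewrite /check_time; lia.
apply: (surely_seq (shift_spec rs cs ks)) => s1 [ss1 cs1].
have rs1 : reads s1 by apply: same_reads ss1 rs.
have sb1 : s1 side 0 = b by rewrite ss1.
apply: (surely_seq (parity_spec rs1 cs1 sb1)) => s2 [ss2 e2].
have rs2 : reads s2 by apply: same_reads ss2 rs1.
have cs2 : coded s2 r x' by apply: same_coded ss2 cs1.
have sb2 : s2 side 0 = b by rewrite ss2.
apply: (surely_seq (measure_spec rs2 cs2 sb2)) => s3 [ss3 z3].
have cs3 : coded s3 r x' by apply: same_coded ss3 cs2.
have e3 : s3 parity 0 = (tau_sum X == side_alpha I b) by rewrite ss3.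
apply: surely_le (record_spec e3) _ _ => // s4 [ss4 b4]; split.
- have f1 : same A s s1 by apply: same_sub ss1.
  have f2 : same A s1 s2 by apply: same_sub ss2.
  have f3 : same A s2 s3 by apply: same_sub ss3.
  have f4 : same A s3 s4 by apply: same_sub ss4.
  exact: same_trans f1 (same_trans f2 (same_trans f3 f4)).
- by apply: same_coded ss4 cs3.
- by rewrite b4 z3 ss3 // ss2 // ss1.
Qed.

(** The tossed set is uniform, so it lies in [G] with probability [#|G| / 2 ^ n]. The potential
    [phi] tracks the fraction of members of [G] among the completions of the coins seen so far. *)
Lemma toss_spec (s : memory) (G : {set {set V}}) (lo hi : R) (P : memory -> Prop)
    (g : memory -> R) :
  reads s -> (lo <= hi)%R ->
  (forall s' Y, same [:: coin; i1] s s' -> coins s' Y ->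
     P s' /\ ((if Y \in G then hi else lo) <= g s')%R) ->
  triple W s toss_coins (n * (1 + 3) + 3) P g
    (lo + (hi - lo) * (#|G|%:R / (2 ^ n)%:R))%R.
Proof.
move=> rs le_lohi HP; pose A := [:: coin; i1].
pose agree k (s' : memory) := [set Y in G | [forall v : V, (v < k) ==> (s' coin v == (v \in Y))]].
pose J k (s' : memory) := [/\ same A s s', s' i1 0 = k & forall v : V, v < k -> s' coin v < 2].
pose phi k (s' : memory) : R := (lo + (hi - lo) * (#|agree k s'|%:R / (2 ^ (n - k))%:R))%R.
have agree0 s' : agree 0 s' = G.
  by apply/setP => Y; rewrite inE; case: (Y \in G) => //=; apply/forallP.
have -> : (lo + (hi - lo) * (#|G|%:R / (2 ^ n)%:R) = phi 0 (update s i1 0 0))%R.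
  by rewrite /phi agree0 subn0.
apply: (@triple_le _ _ _ _ _ _ _ _ _ (J n) (phi n) _ _ (leqnn _) (lexx _)); last first.
  move=> s' [ss _ s2]; pose Y := [set v : V | s' coin v == 1].
  have ks : coins s' Y by move=> v; rewrite inE; case: (s' coin v) (s2 v (ltn_ord v)) => [|[]].
  have [Ps le_g] := HP s' Y ss ks; split=> //; apply: le_trans _ le_g.
  rewrite /phi subnn expn0 divr1; suff -> : #|agree n s'| = (Y \in G).
    by case: (Y \in G); rewrite ?mulr0 ?addr0 // mulr1 addrCA subrr addr0.
  case: (boolP (Y \in G)) => YG.
    rewrite (_ : agree n s' = [set Y]) ?cards1 //; apply/setP => Z; rewrite !inE.
    apply/andP/eqP => [[_ /forallP H]|->].
      apply/setP => v; have := H v; rewrite ltn_ord ks /=.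
      by do 2!case: (v \in _).
    by split => //; apply/forallP => v; rewrite ks eqxx implybT.
  apply/eqP; rewrite cards_eq0; apply/set0Pn => -[Z]; rewrite inE => /andP [ZG /forallP H].
  move/negP: YG; apply; rewrite (_ : Y = Z) //; apply/setP => v; have := H v.
  by rewrite ltn_ord ks /=; do 2!case: (v \in _).
apply: (triple_for (J := J)).
- by lia.
- by lia.
- by split=> //; exact: same_update.
- by move=> k s' _ [ss sk _]; split => //; exact: eval_nv ss.
- move=> k s' kn [ss sk s2]; pose v : V := Ordinal kn.
  have ek : eval W s' (var i1) = k by ev.
  have e1 : eval W s' (Const 1) = 1 by ev; lia.
  have agreeS c Y : (Y \in agree k.+1 (update (update s' coin k c) i1 0 k.+1)) =
      (Y \in agree k s') && (c == (v \in Y)).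
    rewrite !inE -andbA; congr andb; apply/forallP/andP => [H|[/forallP H /eqP Hv] w].
      split; last by have := H v; rewrite ltnSn /update /= eqxx.
      apply/forallP => w; apply/implyP => wk; have := H w.
      by rewrite (ltnW wk : w < k.+1) /update /= (ltn_eqF wk).
    apply/implyP; rewrite ltnS leq_eqVlt /update /=; case: eqP => [wk _|_ /= wk].
      by rewrite (_ : w = v) -?Hv //; apply: val_inj.
    exact: (implyP (H w)).
  (* The next coin splits the completions in two, which makes [phi k] the mean of the two values of
     [phi k.+1]. *)
  have cardS : #|agree k s'| = #|agree k.+1 (update (update s' coin k 0) i1 0 k.+1)| +
      #|agree k.+1 (update (update s' coin k 1) i1 0 k.+1)|.
    rewrite -(cardsID [set Y : {set V} | v \in Y]) addnC; congr (_ + _).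
      apply: eq_card => Y; rewrite agreeS in_setD andbC.
      by case: (Y \in agree k s'); rewrite //= inE; case: (v \in Y).
    apply: eq_card => Y; rewrite agreeS in_setI.
    by case: (Y \in agree k s'); rewrite //= inE; case: (v \in Y).
  apply: triple_le (triple_random (e := Const 1) (g := fun s0 => phi k.+1 (update s0 i1 0 k.+1)) _)
      (leqnn _) _ (fun s0 H => conj H (lexx _)).
    rewrite e1 ek => c c1; split => //; split => //; first by do 2!apply: same_update => //.
    by move=> w; rewrite ltnS leq_eqVlt /update /=; case: eqP => //= _; apply: s2.
  rewrite e1 ek big_ltn // big_nat1 /phi cardS natrD.
  have -> : n - k = (n - k.+1).+1 by lia.
  rewrite expnS natrM.
  have p0 : ((2 ^ (n - k.+1))%:R != 0 :> R)%R by rewrite pnatr_eq0 -lt0n expn_gt0.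
  rewrite le_eqVlt; apply/orP; left; apply/eqP; field.
  exact: p0.
- by [].
Qed.
(** A uniform position in the list of crossing edges is a uniform crossing edge; [G e] bounds from
    below what contracting [e] is worth. *)
Lemma contract_spec s r x (b : bool) (G : E -> R) (P : memory -> Prop) (g : memory -> R) :
  reads s -> coded s r x -> s side 0 = b -> s pool_size 0 = #|crossing r| ->
  (forall i, i < #|crossing r| ->
     s pool i = nth 0 [seq nat_of_ord e | e <- enum (crossing r)] i) ->
  0 < #|crossing r| ->
  (forall e s', e \in crossing r ->
     same [:: label; bit; i1; pick; label1; label2; flip] s s' ->
     coded s' (merge_label r e) (merge_bit b r x e) -> P s' /\ (G e <= g s')%R) ->
  triple W s contract (n * (4 + 3) + 14) P g
    ((\sum_(e in crossing r) G e) / #|crossing r|%:R)%R.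
Proof.
move=> rs cs sb sl sL d0 HP; set A := [:: _; _; _; _; _; _; _] in HP.
have le_d : #|crossing r| <= m by rewrite -[X in _ <= X]card_ord max_card.
rewrite (_ : _ + 14 = (1 + (1 + (n * (4 + 3) + 9)).+1).+2); last by lia.
apply: triple_if; rewrite (eval_var _ sl) -lt0n d0.
pose e0 := enum_val (Ordinal d0).
pose G1 (s1 : memory) := G (nth e0 (enum (crossing r)) (s1 pick 0)).
apply: (@triple_seq _ _ _ _ _ _ _ (fun s1 => same [:: pick] s s1 /\ s1 pick 0 < #|crossing r|) G1).
  (* [Random] includes its upper bound, so subtracting 1 leaves exactly [#|crossing r|] outcomes. *)
  have e1 : eval W s (Op BSub (var pool_size) (Const 1)) = #|crossing r|.-1.
    by rewrite -subn1; ev; lia.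
  have := @triple_random W R s (fun s1 => same [:: pick] s s1 /\ s1 pick 0 < #|crossing r|) G1
     pick (Const 0) (Op BSub (var pool_size) (Const 1)).
  rewrite e1 eval_const; last lia.
  rewrite (prednK d0).
  rewrite (_ : (\sum_(0 <= i < #|crossing r|) _ = \sum_(e in crossing r) G e)%R).
    apply=> i lt_i; split; first exact: same_update.
    by rewrite /update /= -(prednK d0) ltnS.
  rewrite -big_enum /= (big_nth e0) -cardE; apply: eq_big_nat => i _.
  by rewrite /G1 /update.
move=> s1 [ss1 lt_p]; set e := nth e0 (enum (crossing r)) (s1 pick 0).
have eD : e \in crossing r by rewrite -mem_enum mem_nth // -cardE.
apply: (triple_seql (P1 := fun s' => same [:: pick] s s' /\ s' pick 0 = e)).
  apply: surely_assign; rewrite eval_const; last lia.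
  have -> : eval W s1 (Get pool (var pick)) = e.
    ev; rewrite ss1 // sL // (nth_map e0) // -cardE //.
  by split => //; apply: same_update.
move=> s2 [ss2 ep].
have rs2 : reads s2 by apply: same_reads ss2 rs.
have cs2 : coded s2 r x by apply: same_coded ss2 cs.
have sb2 : s2 side 0 = b by rewrite ss2.
apply: triple_le (@merge_spec _ _ _ _ _ rs2 cs2 sb2 ep (G1 s1)) (leqnn _) (lexx _) _ => s3 [ss3 cs3].
have f2 : same A s s2 by apply: same_sub ss2.
have f3 : same A s2 s3 by apply: same_sub ss3.
exact: HP e s3 eD (same_trans f2 f3) cs3.
Qed.

End Specifications.

(** * Probabilistic analysis *)

Section Analysis.
Variables (W : nat) (R : realType) (t : nat) (I : instance t).
Local Notation n := (nv I).
Local Notation m := (ne I).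
Local Notation V := 'I_n.
Local Notation E := 'I_m.
Implicit Types (b : bool) (X : {set V}) (F : {set E}) (r : V -> V) (x : V -> bool).
Implicit Types (s : memory).
Hypothesis W_large : n * t + 2 * m + n + t + 24 < W.
Local Notation surely := (surely W R).
Local Notation triple := (triple W).

(* [0] stands for an instance without feasible set. *)
Variable k : nat.
Hypothesis k_opt : is_optimal_value I (if k == 0 then None else Some k).

Definition sound_best (old : nat) := old = 0 \/ exists2 F : {set E}, feasible F & #|F| = old.

Lemma opt_min (F : {set E}) : feasible F -> 0 < k <= #|F|.
Proof.
case: eqP k_opt => [_ /forallP /(_ F) /negPf -> //|/eqP k0 /andP [_ /forallP H] fF].
by rewrite lt0n k0 /=; have := H F; rewrite fF.
Qed.

Lemma sound_better old b X : sound_best old ->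
  sound_best (better old #|side_cut b X| (tau_sum X == side_alpha I b)).
Proof.
move=> so; rewrite /better; case: ifP => // /andP [/andP [/eqP tX c0] _].
right; exists (side_cut b X) => //; apply/feasibleP; split; first by rewrite -card_gt0.
by exists b, X.
Qed.

(** A recorded optimum is never replaced; for [k = 0] because there is no feasible set to record. *)
Lemma better_opt b X : better k #|side_cut b X| (tau_sum X == side_alpha I b) = k.
Proof.
rewrite /better; case: ifP => // /andP [/andP [/eqP tX c0]].
have /opt_min : feasible (side_cut b X).
  by apply/feasibleP; split; [rewrite -card_gt0 | exists b, X].
by move=> /andP [k0 le_k]; rewrite -leqn0 leqNgt k0 /= ltnNge le_k.
Qed.

Lemma better_hit old b X F : sound_best old -> feasible F -> #|F| = k ->
  tau_sum X = side_alpha I b -> side_cut b X = F ->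
  better old #|side_cut b X| (tau_sum X == side_alpha I b) = k.
Proof.
move=> so fF Fk tX cX; have /andP [k0 _] := opt_min fF.
rewrite /better cX tX eqxx Fk k0 /=.
case: so => [->|[F' fF' <-]] //; have /andP [_] := opt_min fF'.
by rewrite leq_eqVlt => /orP [/eqP <-|->]; rewrite ?ltnn ?orbT //; case: ifP.
Qed.

(** Labels are read back from the memory so that potentials depend on the memory alone. The default
    [v] does not arise for [coded] memories. *)
Definition label_of (s : memory) (v : V) : V := insubd v (s label v).
Definition bit_of (s : memory) (v : V) : bool := s bit v == 1.

Lemma coded_label s r x : coded s r x -> label_of s = r.
Proof. by move=> cs; apply/funext => v; apply: val_inj; rewrite val_insubd; case: (cs v) => -> _; rewrite ltn_ord. Qed.

Lemma coded_bit s r x : coded s r x -> bit_of s = x.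
Proof. by move=> cs; apply/funext => v; rewrite /bit_of; case: (cs v) => _ ->; case: (x v). Qed.

(** [A] is the credit for a run that fails; it will be the success probability guaranteed by the
    remaining runs. *)
Variable A : R.
Hypothesis A01 : (0 <= A <= 1)%R.

Definition promising (b : bool) (r : V -> V) (x : V -> bool) : Prop :=
  exists F, [/\ feasible F, #|F| = k & reachable b r x F].

(** [fuel] is the number of iterations left. As every contraction kills a label, [#|live r| <= fuel]
    leaves enough of them to reach few live labels, and [0 < fuel] leaves room for a check. *)
Definition chance (b : bool) (r : V -> V) (x : V -> bool) (fuel : nat) : R :=
  if `[< promising b r x >] && (#|live r| <= fuel) && (0 < fuel)
  then run_prob R t #|live r| else 0%R.

(** The potential of a run, a lower bound on the credit expected when [fuel] iterations remain. *)
Definition value (b : bool) (fuel : nat) (s : memory) : R :=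
  if s best 0 == k then 1%R
  else (A + (1 - A) * chance b (label_of s) (bit_of s) fuel)%R.

Definition inv (b : bool) (s : memory) :=
  [/\ reads I s, exists r x, coded (I := I) s r x, s side 0 = b & sound_best (s best 0)].

Lemma run_prob_le1 h : (run_prob R t h <= 1)%R.
Proof.
apply: le_trans (_ : (check_prob R t <= 1)%R).
  rewrite /run_prob ler_pdivrMr ?ltr0n ?bin_max_gt0 // ler_peMr ?(ltW (check_prob_gt0 _ _)) //.
  by rewrite ler1n bin_max_gt0.
by rewrite invf_le1 ?ltr0n ?expn_gt0 // ler1n expn_gt0.
Qed.

Lemma chance_ge0 b r x fuel : (0 <= chance b r x fuel)%R.
Proof. by rewrite /chance; case: ifP => // _; apply: run_prob_ge0. Qed.

Lemma mix_ge (q : R) : (0 <= q)%R -> (A <= A + (1 - A) * q)%R.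
Proof. by move=> q0; case/andP: A01 => _ A1; rewrite lerDl mulr_ge0 // subr_ge0. Qed.

Lemma mix_le1 (q : R) : (q <= 1)%R -> (A + (1 - A) * q <= 1)%R.
Proof.
move=> q1; case/andP: A01 => _ A1.
have : ((1 - A) * q <= (1 - A) * 1)%R by rewrite ler_wpM2l // subr_ge0.
by lra.
Qed.

Lemma mix_mono (q q' : R) : (q <= q')%R -> (A + (1 - A) * q <= A + (1 - A) * q')%R.
Proof. by move=> le_q; case/andP: A01 => _ A1; rewrite lerD2l ler_wpM2l // subr_ge0. Qed.

Lemma value_ge b fuel s : (A <= value b fuel s)%R.
Proof.
rewrite /value; case: ifP => _; first by case/andP: A01.
exact/mix_ge/chance_ge0.
Qed.

(* With few live labels only the check is credited, so contracting counts for
   nothing there. *)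
Definition value_contract (b : bool) (fuel : nat) (s : memory) : R :=
  if s best 0 == k then 1%R
  else if `[< promising b (label_of s) (bit_of s) >] &&
       (2 ^ t.+1 + 4 < #|live (label_of s)| <= fuel)
  then (A + (1 - A) * run_prob R t #|live (label_of s)|)%R else A.

Definition contract_time := (m * (4 + 3) + 5 + (n * (4 + 3) + 14)).+1.

Definition scratch := [:: best; label; bit; coin; pool; i1; i2; parity; acc; cut_size; pool_size; pick;
  label1; label2; flip].

(** Contracting one of the at most [k] crossing edges in an optimal [F] falls back to [A]; any other
    keeps [F] and lowers the number of live labels. [run_prob_step] averages the two cases. *)
Lemma contract_step s b fuel : inv b s ->
  triple s (Seq list_crossing contract) contract_time
    (fun s' => inv b s' /\ same scratch s s') (value b fuel) (value_contract b fuel.+1 s).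
Proof.
move=> [rs [r [x cs]] sb so].
have er := coded_label cs; have ex := coded_bit cs.
apply: (triple_seql (list_spec W_large rs cs)) => s1 [ss1 sl sL].
have rs1 : reads I s1 by apply: same_reads ss1 rs.
have cs1 : coded s1 r x by apply: same_coded ss1 cs.
have sb1 : s1 side 0 = b by rewrite ss1.
have f1 : same scratch s s1 by apply: same_sub ss1.
(* Without crossing edges no label is live, so only [A] is owed unless the optimum is already
   recorded. *)
case: (posnP #|crossing r|) => [d0|d_gt0].
  have live0 : #|live r| = 0.
    apply/eqP; rewrite cards_eq0; apply/set0Pn => -[l /liveP [e eD _]].
    by move/eqP: d0; rewrite cards_eq0 => /eqP d0; rewrite d0 inE in eD.
  apply: (@triple_le _ _ _ _ _ _ _ _ 2 (eq s1) (fun=> value_contract b fuel.+1 s)); last first.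
  - move=> _ <-; split; first by split=> //; split => //; [exists r, x | rewrite ss1].
    rewrite /value_contract /value er live0 andbF ss1 //.
    by case: ifP => // _; apply/mix_ge/chance_ge0.
  - exact: lexx.
  - by lia.
  apply: triple_if; rewrite (eval_var _ sl) d0 /=.
  exact: (triple_skip (g := fun=> _)).
have next e s' : e \in crossing r ->
    same [:: label; bit; i1; pick; label1; label2; flip] s1 s' ->
    coded s' (merge_label r e) (merge_bit b r x e) ->
    inv b s' /\ same scratch s s'.
  move=> _ ss' cs'; have rs' : reads I s' by apply: same_reads ss' rs1.
  have f2 : same scratch s1 s' by apply: same_sub ss'.
  split; last exact: same_trans f1 f2.
  split => //; [by exists (merge_label r e), (merge_bit b r x e) | by rewrite ss' | by rewrite ss' // ss1].
have step (G : E -> R) :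
    (forall e s', e \in crossing r -> s' best 0 = s best 0 ->
      coded s' (merge_label r e) (merge_bit b r x e) -> (G e <= value b fuel s')%R) ->
    triple s1 contract (n * (4 + 3) + 14) (fun s' => inv b s' /\ same scratch s s')
      (value b fuel) ((\sum_(e in crossing r) G e) / #|crossing r|%:R)%R.
  move=> HG; apply: (contract_spec W_large rs1 cs1 sb1 sl sL d_gt0) => e s' eD ss' cs'.
  by split; [exact: next ss' cs' | apply: HG cs' => //; rewrite ss' // ss1].
have d_neq0 : (#|crossing r|%:R != 0 :> R)%R by rewrite pnatr_eq0 -lt0n.
have step_const (v : R) : (forall s', s' best 0 = s best 0 -> (v <= value b fuel s')%R) ->
    triple s1 contract (n * (4 + 3) + 14) (fun s' => inv b s' /\ same scratch s s')
      (value b fuel) v.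
  move=> Hv; have := step (fun=> v) (fun _ s' _ sbest _ => Hv s' sbest).
  by rewrite sumr_const -[X in (X / _)%R]mulr_natr mulfK.
rewrite /value_contract er ex; case: ifP => sbest.
  by apply: step_const => s' e; rewrite /value e sbest.
case: ifP => [/andP [/asboolP [F [fF Fk reF]] /andP [big_live le_live]]|_]; last first.
  by apply: step_const => s' _; apply: value_ge.
set h := #|live r| in big_live le_live *.
pose G e := if e \in F then A else (A + (1 - A) * run_prob R t h.-1)%R.
have HG e s' : e \in crossing r -> s' best 0 = s best 0 ->
    coded s' (merge_label r e) (merge_bit b r x e) -> (G e <= value b fuel s')%R.
  move=> eD e1 cs'; rewrite /G; case: ifP => [_|/negbT eF]; first exact: value_ge.
  have le_h : #|live (merge_label r e)| <= h.-1.
    by rewrite -ltnS (ltn_predK big_live); apply: card_live_merge.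
  rewrite /value e1 sbest (coded_label cs') (coded_bit cs') /chance.
  rewrite asboolT /=; last by exists F; split => //; apply: reachable_merge.
  have -> : (#|live (merge_label r e)| <= fuel) && (0 < fuel).
    have h4 : 4 < h by apply: leq_ltn_trans big_live; rewrite leq_addl.
    have hf : h.-1 <= fuel by rewrite -ltnS (ltn_predK big_live).
    rewrite (leq_trans le_h hf) (leq_trans _ hf) //.
    by rewrite -ltnS (ltn_predK big_live); apply: leq_trans h4.
  by apply/mix_mono/run_prob_anti.
apply: triple_le (step G HG) (leqnn _) _ (fun s' H => conj H (lexx _)).
rewrite ler_pdivlMr ?ltr0n // (big_setID F) /=.
rewrite (eq_bigr (fun=> A)); last by move=> e /setIP [_ eF]; rewrite /G eF.
rewrite [X in (_ <= _ + X)%R](eq_bigr (fun=> A + (1 - A) * run_prob R t h.-1)%R); last first.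
  by move=> e /setDP [_ /negPf eF]; rewrite /G eF.
rewrite !sumr_const.
have d_split := cardsID F (crossing r).
have le_k : #|crossing r :&: F| <= k by rewrite -Fk subset_leq_card // subsetIr.
have := run_prob_step R big_live (crossing_lower_bound (k := k) (fun F fF => proj2 (andP (opt_min fF))) r).
rewrite -d_split natrD.
move: #|_ :&: _| #|_ :\: _| le_k => a c le_k.
have := run_prob_ge0 R t h.-1; move: (run_prob R t h.-1) (run_prob R t h) => q q' q0 stepq.
have ak : (a%:R <= k%:R :> R)%R by rewrite ler_nat.
(* As [a <= k], the difference [d - k] is at most the number [c] of harmless edges. *)
have : (q' * (a%:R + c%:R) <= q * c%:R)%R.
  by apply: le_trans stepq _; rewrite ler_wpM2l // lerBlDr addrC lerD2l.
rewrite -(mulr_natr A a) -(mulr_natr (A + _)%R c) => H.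
have A1 : (0 <= 1 - A)%R by case/andP: A01 => _; rewrite subr_ge0.
move: a%:R%R c%:R%R H {ak stepq le_k} => x1 x2 H.
have -> : ((A + (1 - A) * q') * (x1 + x2) = A * (x1 + x2) + (1 - A) * (q' * (x1 + x2)))%R.
  by ring.
have -> : (A * x1 + (A + (1 - A) * q) * x2 = A * (x1 + x2) + (1 - A) * (q * x2))%R by ring.
by rewrite lerD2l ler_wpM2l.
Qed.

Lemma check_contract_step s r x b fuel Y (v : R) : inv b s -> coded s r x -> coins s Y ->
  (forall s', coded s' r (fun w => x w (+) (r w \in Y)) ->
     let X := [set w | x w (+) (r w \in Y)] in
     s' best 0 = better (s best 0) #|side_cut b X| (tau_sum X == side_alpha I b) ->
     (v <= value_contract b fuel.+1 s')%R) ->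
  triple s (Seq (check t) (Seq list_crossing contract)) (check_time I + contract_time).+1
    (fun s' => inv b s' /\ same scratch s s') (value b fuel) v.
Proof.
move=> [rs _ sb so] cs ks Hv.
apply: (triple_seql (check_spec W_large rs cs sb ks)) => s1 [ss1 cs1 b1].
have f1 : same scratch s s1 by apply: same_sub ss1.
have inv1 : inv b s1.
  split; [by apply: same_reads f1 rs | by eexists; eexists; exact: cs1 | by rewrite ss1 |].
  by rewrite b1; apply: sound_better.
apply: triple_le (contract_step (fuel := fuel) inv1) (leqnn _) (Hv _ cs1 b1) _ => s2 [inv2 f2].
by split => //; split => //; apply: same_trans f1 f2.
Qed.

Definition iteration_time := (n * (1 + 3) + 3 + (check_time I + contract_time).+1).+1.

(** A recorded optimum stays. With many live labels the shift keeps [F] and the contraction accounts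
    for the loss; with few, the check alone earns the claimed chance. *)
Lemma iteration_step s b fuel : inv b s ->
  triple s (iteration t) iteration_time
    (fun s' => inv b s' /\ same scratch s s') (value b fuel) (value b fuel.+1 s).
Proof.
move=> inv_s; have [rs [r [x cs]] sb so] := inv_s.
have er := coded_label cs; have ex := coded_bit cs.
have toss (G : {set {set V}}) (lo hi : R) : (lo <= hi)%R ->
    (forall s' (Y : {set V}), coded s' r (fun w => x w (+) (r w \in Y)) ->
     let X := [set w | x w (+) (r w \in Y)] in
     s' best 0 = better (s best 0) #|side_cut b X| (tau_sum X == side_alpha I b) ->
     ((if Y \in G then hi else lo) <= value_contract b fuel.+1 s')%R) ->
    triple s (iteration t) iteration_time (fun s' => inv b s' /\ same scratch s s')
      (value b fuel) (lo + (hi - lo) * (#|G|%:R / (2 ^ n)%:R))%R.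
  move=> le_lohi HG; pose coins_of (s' : memory) := [set v : V | s' coin v == 1].
  apply: (@triple_seq _ _ _ _ _ _ _
    (fun s' => same [:: coin; i1] s s' /\ exists Y, coins s' Y)
    (fun s' => if coins_of s' \in G then hi else lo)).
    apply: (toss_spec W_large rs le_lohi) => s' Y ss' ks.
    split; first by split => //; exists Y.
    rewrite (_ : coins_of s' = Y) //; apply/setP => v; rewrite inE ks.
    by case: (v \in Y).
  move=> s1 [ss1 [Y ks]].
  have -> : coins_of s1 = Y by apply/setP => v; rewrite inE ks; case: (v \in Y).
  have f1 : same scratch s s1 by apply: same_sub ss1.
  have cs1 : coded s1 r x by apply: same_coded ss1 cs.
  have inv1 : inv b s1.
    split; [by apply: same_reads f1 rs | by exists r, x | by rewrite ss1 | by rewrite ss1].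
  apply: triple_le (check_contract_step (fuel := fuel) inv1 cs1 ks _) (leqnn _) (lexx _) _.
    by move=> s' cs' X e; apply: HG cs' _; rewrite e ss1.
  by move=> s2 [inv2 f2]; split => //; split => //; apply: same_trans f1 f2.
have toss_const (v : R) :
    (forall s' (Y : {set V}), coded s' r (fun w => x w (+) (r w \in Y)) ->
     let X := [set w | x w (+) (r w \in Y)] in
     s' best 0 = better (s best 0) #|side_cut b X| (tau_sum X == side_alpha I b) ->
     (v <= value_contract b fuel.+1 s')%R) ->
    triple s (iteration t) iteration_time (fun s' => inv b s' /\ same scratch s s')
      (value b fuel) v.
  move=> Hv; have := toss set0 v v (lexx _) (fun s' Y => _).
  by rewrite subrr mul0r addr0; apply=> s' Y cs' X e; rewrite inE; apply: Hv cs' e.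
have contract_ge s' : (A <= value_contract b fuel.+1 s')%R.
  rewrite /value_contract; case: ifP => _; first by case/andP: A01.
  by case: ifP => // _; apply/mix_ge/run_prob_ge0.
rewrite /value; case: eqP => [sk|_].
  apply: toss_const => s' Y _ /=; rewrite sk better_opt => sk'.
  by rewrite /value_contract sk' eqxx.
rewrite er ex /chance; case: ifP => [/andP [/andP [/asboolP pr le_live] _]|_]; last first.
  by rewrite mulr0 addr0; apply: toss_const.
have [F [fF Fk reF]] := pr.
case: (leqP #|live r| (2 ^ t.+1 + 4)) => [small|big_live]; last first.
  apply: toss_const => s' Y cs' /= _; rewrite /value_contract.
  case: ifP => _; first exact/mix_le1/run_prob_le1.
  rewrite (coded_label cs') (coded_bit cs') big_live le_live /= asboolT //.
  by exists F; split => //; apply: (reachable_shift (fun l => l \in Y)).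
set G := [set Y : {set V} | let X := [set w | x w (+) (r w \in Y)] in
        (tau_sum X == side_alpha I b) && (side_cut b X == F)].
have hits : 2 ^ n <= 2 ^ (#|live r| + t) * #|G| := card_hits reF.
apply: triple_le (toss G A 1%R _ _) (leqnn _) _ (fun s' H => conj H (lexx _)).
- by case/andP: A01.
- move=> s' Y cs' X e; case: ifP => // YG.
  move: YG; rewrite inE => /andP [/eqP tX /eqP cX].
  by rewrite /value_contract e (better_hit so fF Fk tX cX) eqxx.
(* What remains is [check_prob <= #|G| / 2 ^ n], that is [card_hits] for at most [2 ^ t.+1 + 4] live
   labels. *)
apply: mix_mono; rewrite run_prob_small //.
rewrite ler_pdivlMr ?ltr0n ?expn_gt0 // /check_prob mulrC.
rewrite ler_pdivrMr ?ltr0n ?expn_gt0 // -natrM ler_nat mulnC.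
apply: leq_trans hits _; rewrite leq_mul2r; apply/orP; right.
by rewrite leq_pexp2l // leq_add2r.
Qed.

(** Initially each vertex is its own class, so this says that side [b] has an optimal set. *)
Definition start (b : bool) : bool := `[< promising b id xpred0 >].

(** The division by 2 accounts for the guess of [side]. *)
Definition one_run_prob : R := (check_prob R t / (n ^ 4)%:R / 2)%R.

Definition goal_value (s : memory) : R := if s best 0 == k then 1%R else A.

Definition rounds := n - (n - (m + m)).

Definition one_run_time := (1 + (n * (3 + 3) + 3 + (rounds * (iteration_time + 3) + 3)).+1).+1.

Lemma eval_rounds s : reads I s -> eval W s e_rounds = rounds.
Proof.
move=> rs; have h1 : s 0 0 = n by rewrite rs.
have h2 : s 0 1 = m by rewrite rs.
by rewrite /e_rounds /e_nv /e_ne /rounds; ev; lia.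
Qed.

(** A suitable side is guessed with probability at least one half; the initial labelling then has at
    most [rounds] live labels, so the fuel suffices. *)
Lemma one_run_step s : 0 < n -> 0 < m -> reads I s -> sound_best (s best 0) ->
  triple s (one_run t) one_run_time
    (fun s' => [/\ reads I s', sound_best (s' best 0) & same [:: iter, side & scratch] s s'])
    goal_value (if s best 0 == k then 1%R else (A + (1 - A) * one_run_prob)%R).
Proof.
move=> n0 m0 rs so; have /andP [A0 A1] := A01.
set q := (check_prob R t / (n ^ 4)%:R)%R.
pose P1 (s1 : memory) := same [:: side] s s1 /\ s1 side 0 <= 1.
pose run_value (c : nat) := if s best 0 == k then 1%R else
  (A + (1 - A) * (if start (c == 1%N) then q else 0))%R.
apply: (@triple_seq _ _ _ _ _ _ _ P1 (fun s1 => run_value (s1 side 0))).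
  have e1 : eval W s (Const 1) = 1 by ev; lia.
  apply: triple_le (triple_random (e := Const 1) (P := P1)
    (g := fun s1 => run_value (s1 side 0)) _) (leqnn _) _ (fun s' H => conj H (lexx _)).
    move=> c; rewrite e1 eval_const; last lia.
    by move=> c1; split => //; apply: same_update.
  rewrite e1 eval_const; last lia.
  rewrite big_ltn // big_nat1 /update /= /run_value; case: eqP => [_|nk].
    by rewrite ler_pdivlMr ?ltr0n // mulr_natr.
  (* As [best] differs from [k], soundness excludes [k = 0]; so an optimal set exists, and it
     belongs to some side. *)
  have [b sb] : exists b, start b.
    have k0 : k != 0.
      apply/eqP => k0; case: so => [b0|[F fF _]]; first by rewrite b0 k0 in nk.
      by have := opt_min fF; rewrite k0.
    move: k_opt; rewrite (negPf k0) => /andP [/existsP [F /andP [fF /eqP Fk]] _].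
    have /feasibleP [_ [b [X [tX FX]]]] := fF.
    exists b; apply/asboolP; exists F; split => //; exists X.
    by rewrite (_ : [set v | xpred0 v (+) (id v \in X)] = X) //; apply/setP => v; rewrite inE.
  have q0 : (0 <= q)%R by rewrite divr_ge0 ?ler0n // ltW // check_prob_gt0.
  have mq := mix_ge q0.
  have -> : (A + (1 - A) * one_run_prob = (A + (A + (1 - A) * q)) / 2)%R.
    by rewrite /one_run_prob -/q; field.
  rewrite ler_pM2r ?invr_gt0 ?ltr0n //.
  case: b sb => ->; case: (start _); rewrite ?mulr0 ?addr0 ?lerD2r ?lerD2l //.
  by rewrite addrC lerD2l.
move=> s1 [ss1 le1]; pose b := s1 side 0 == 1.
have sb : s1 side 0 = b by rewrite /b; case: (s1 side 0) le1 => [|[]].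
have rs1 : reads I s1 by apply: same_reads ss1 rs.
apply: (triple_seql (reset_spec W_large rs1)) => s2 [ss2 cs2].
have rs2 : reads I s2 by apply: same_reads ss2 rs1.
have inv2 : inv b s2.
  split => //; [by exists id, xpred0 | by rewrite ss2 | by rewrite ss2 // ss1].
have f2 : same [:: iter, side & scratch] s s2.
  have g1 : same [:: iter, side & scratch] s s1 by apply: same_sub ss1.
  have g2 : same [:: iter, side & scratch] s1 s2 by apply: same_sub ss2.
  exact: same_trans g1 g2.
pose J j s' := [/\ inv b s', same [:: iter, side & scratch] s s' & s' iter 0 = j].
have inv_iter j s' : inv b s' -> inv b (update s' iter 0 j).
  move=> [rs' [r [x cs']] sb' so']; split => //; last by exists r, x.
  have ss' : same [:: iter] s' (update s' iter 0 j) by apply: same_update.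
  by apply: same_reads ss' rs'.
apply: (@triple_le _ _ _ _ _ _ _ _ _ (J rounds) (fun s' => value b (rounds - rounds) s')
  (value b (rounds - 0) (update s2 iter 0 0)) _ (leqnn _)); last first.
(* Once the fuel is used up the chance is 0, and [value] becomes [goal_value]. *)
- move=> s' [[rs' _ _ so'] f _]; split => //.
  by rewrite /value /goal_value subnn /chance andbF mulr0 addr0.
- rewrite /run_value subn0 /value (_ : update s2 iter 0 0 best 0 = s best 0); last first.
    by rewrite /update /= ss2 // ss1.
  case: ifP => // _; apply: mix_mono; rewrite -/b /chance.
  rewrite (coded_label (cs2 : coded (update s2 iter 0 0) _ _)).
  rewrite (coded_bit (cs2 : coded (update s2 iter 0 0) _ _)) -/(start b).
  case: (start b) => //=.
  have le_live := card_live_le (I := I) id.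
  rewrite (_ : _ && _); first by apply: run_prob_lower_bound => //; apply: leq_trans le_live (geq_minl _ _).
  rewrite (_ : rounds = minn n (2 * m)) ?le_live ?leq_min ?n0 ?muln_gt0 //.
  by rewrite minnE mul2n -addnn.
apply: (triple_for (J := J) (g := fun j s' => value b (rounds - j) s')).
- lia.
- by rewrite /rounds; lia.
- by split => //; [exact: inv_iter | exact: same_update].
- by move=> j s' _ [[rs' _ _ _] _ sj]; split=> //; apply: eval_rounds.
- move=> j s' lt_j [inv' f' sj].
  have -> : rounds - j = (rounds - j.+1).+1 by lia.
  apply: triple_le (iteration_step (fuel := rounds - j.+1) inv') (leqnn _) (lexx _) _ => s3 [inv3 f3].
  split; last exact: lexx.
  have f4 : same [:: iter, side & scratch] s' s3 by apply: same_sub f3.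
  split; first by rewrite f3.
  by split => //; [exact: inv_iter | apply: same_update => //; apply: same_trans f' f4].
- by [].
Qed.

End Analysis.

(** * Independent repetition of runs *)

Section Amplification.
Variables (W : nat) (R : realType) (t : nat) (I : instance t) (runs k : nat).
Local Notation n := (nv I).
Local Notation m := (ne I).
Hypothesis W_large : n * t + 2 * m + n + t + 24 < W.
Hypothesis W_runs : runs * n ^ 4 < W.
Hypothesis k_opt : is_optimal_value I (if k == 0 then None else Some k).
Local Notation p := (one_run_prob R I).

Lemma one_run_prob_ge0 : (0 <= p)%R.
Proof. by rewrite !divr_ge0 ?ler0n // ltW // check_prob_gt0. Qed.

Lemma one_run_prob_le1 : (p <= 1)%R.
Proof.
have q1 : (check_prob R t <= 1)%R.
  by rewrite invf_le1 ?ltr0n ?expn_gt0 // ler1n expn_gt0.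
case: (posnP n) => [n0|n0]; first by rewrite /one_run_prob n0 exp0n // invr0 mulr0 mul0r.
rewrite /one_run_prob ler_pdivrMr // ler_pdivrMr ?ltr0n ?expn_gt0 ?n0 //.
by apply: le_trans q1 _; rewrite mul1r -natrM ler1n muln_gt0 expn_gt0 n0.
Qed.

(** As [rounds] is at most [n] and at most [2 * m], its product with [n + m] is at most
    [3 * (n * m)]. *)
Lemma rounds_time : 0 < n -> 0 < m ->
  one_run_time I + 3 <= (18 + 3 * (61 + 15 * t)) * (n * m).
Proof.
move=> n0 m0; have nm : 0 < n * m by rewrite muln_gt0 n0.
(* 61 collects 15 steps per vertex and 46 constant ones; [15 * t] collects [4 * t] per vertex and
   [11 * t]. *)
have le_iter : iteration_time I + 3 <= (61 + 15 * t) * (n + m).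
  rewrite /iteration_time /check_time /contract_time.
  have : t <= t * n by rewrite leq_pmulr.
  by nia.
have r1 : rounds I <= n by rewrite /rounds leq_subr.
have r2 : rounds I <= 2 * m by rewrite /rounds; lia.
have le_rounds : rounds I * (n + m) <= 3 * (n * m).
  by have := leq_mul r2 (leqnn n); have := leq_mul r1 (leqnn m); lia.
have : rounds I * (iteration_time I + 3) <= (61 + 15 * t) * (3 * (n * m)).
  apply: leq_trans (leq_mul (leqnn _) le_iter) _.
  by rewrite mulnCA leq_mul2l le_rounds orbT.
have : n <= n * m by rewrite leq_pmulr.
rewrite /one_run_time; move: (iteration_time I) => T.
by move: (rounds I * _) (n * m) nm => a b; rewrite mulnDl; lia.
Qed.

(** As [n] is positive, every partial product is at most the last one, so none overflows. *)
Lemma eval_runs (s : memory) : 0 < n -> reads I s ->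
  eval W s (Op BMul (Op BMul (Op BMul (Op BMul (Const runs) e_nv) e_nv) e_nv) e_nv) =
    runs * n ^ 4.
Proof.
move=> n0 rs; have h1 : s 0 0 = n by rewrite rs.
have le1 : runs <= runs * n ^ 4 by rewrite leq_pmulr // expn_gt0 n0.
have le2 : runs * n <= runs * n ^ 4 by rewrite leq_mul2l -{1}(expn1 n) leq_pexp2l // orbT.
have le3 : runs * n * n <= runs * n ^ 4.
  by rewrite -mulnA mulnn leq_mul2l leq_pexp2l // orbT.
have le4 : runs * n * n * n <= runs * n ^ 4.
  by rewrite -!mulnA mulnn -expnS leq_mul2l leq_pexp2l // orbT.
have -> : runs * n ^ 4 = runs * n * n * n * n by rewrite !expnS expn0 muln1 !mulnA.
have W4 : runs * n * n * n * n < W.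
  by move: W_runs; rewrite !expnS expn0 muln1 !mulnA.
by rewrite /e_nv; ev; lia.
Qed.

(** All runs fail with probability at most [(1 - p) ^+ N], which [power_decay] bounds. A general [A]
    serves two ends: 1 yields certain halting, 0 the success probability. *)
Lemma program_step (A : R) : (0 <= A <= 1)%R ->
  triple W (input I) (even_cut_program t runs)
    ((runs * (18 + 3 * (61 + 15 * t)) + 4) * (n ^ 5 * m + 1))
    xpredT (goal_value k A) (1 - (1 - A) * (1 + runs%:R * (check_prob R t / 2))^-1)%R.
Proof.
move=> /andP [A0 A1].
have p0 := one_run_prob_ge0.
have rs0 : reads I (input I) by [].
have em : eval W (input I) e_ne = m.
  by rewrite /e_ne; ev; lia.
have best0 : input I best 0 = 0 by exact: input_out.
case: (posnP m) => [m0|m_gt0].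
  have k0 : k = 0.
    move: k_opt; case: eqP => [//|_ /andP [/existsP [F /andP [/feasibleP [F0 _] _]] _]].
    by case/set0Pn: F0 => -[e le_e]; exfalso; rewrite m0 in le_e.
  apply: (@triple_le _ _ _ _ _ _ _ _ 2 (eq (input I)) (fun=> 1%R) 1%R).
  - rewrite /even_cut_program; apply: triple_if; rewrite em m0 /=.
    exact: (triple_skip (g := fun=> _)).
  - by apply: leq_trans (_ : 2 <= 4) _ => //; rewrite mulnDl; lia.
  - by rewrite gerBl mulr_ge0 ?subr_ge0 // invr_ge0 addr_ge0 // mulr_ge0 ?divr_ge0 ?ler0n // ltW ?check_prob_gt0.
  - by move=> _ <-; split => //; rewrite /goal_value best0 k0.
have n_gt0 : 0 < n by case: (ends (Ordinal m_gt0)) => v _; apply: leq_ltn_trans (ltn_ord v).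
pose N := runs * n ^ 4.
pose phi i (s : memory) : R :=
  if s best 0 == k then 1%R else (1 - (1 - A) * (1 - p) ^+ (N - i))%R.
pose J i (s : memory) := [/\ reads I s, sound_best I (s best 0) & s run 0 = i].
have run_reads i s : reads I s -> reads I (update s run 0 i).
  move=> rs; have ss : same [:: run] s (update s run 0 i) by apply: same_update.
  by apply: same_reads ss rs.
have loop : triple W (input I)
    (For run (Op BMul (Op BMul (Op BMul (Op BMul (Const runs) e_nv) e_nv) e_nv) e_nv) (one_run t))
    (N * (one_run_time I + 3) + 3) xpredT (phi N) (phi 0 (update (input I) run 0 0)).
  apply: (triple_for (J := J)).
  - lia.
  - exact: W_runs.
  - by split; [exact: run_reads | left; rewrite /update /= best0 |].
  - by move=> i s _ [rs _ si]; split => //; apply: eval_runs.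
  (* A failing run is credited with what the runs after it guarantee. *)
  - move=> i s lt_i [rs so si]; set A' := (1 - (1 - A) * (1 - p) ^+ (N - i.+1))%R.
    have A'01 : (0 <= A' <= 1)%R.
      have : (0 <= (1 - p) ^+ (N - i.+1) <= 1)%R.
        by rewrite exprn_ge0 ?exprn_ile1 ?subr_ge0 ?one_run_prob_le1 // gerBl.
      move=> /andP [e0 e1]; rewrite /A' gerBl mulr_ge0 ?subr_ge0 // andbT.
      by rewrite mulr_ile1 ?subr_ge0 // gerBl.
    apply: triple_le (one_run_step W_large k_opt A'01 n_gt0 m_gt0 rs so) (leqnn _) _ _.
      rewrite /phi; case: eqP => // _.
      have -> : (N - i = (N - i.+1).+1)%N by lia.
      rewrite exprS /A' le_eqVlt; apply/orP; left; apply/eqP; ring.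
    move=> s' [rs' so' ss']; split; last by [].
    by split; [rewrite ss' | split => //; exact: run_reads].
  - by [].
apply: triple_le (_ : triple _ _ _ _ _ _ _) _ _ _.
- by apply: triple_if; rewrite em -lt0n m_gt0; exact: loop.
- have := rounds_time n_gt0 m_gt0; move: (one_run_time I + 3) => T le_T.
  have : N * T <= N * ((18 + 3 * (61 + 15 * t)) * (n * m)) by rewrite leq_mul2l le_T orbT.
  have -> : N * ((18 + 3 * (61 + 15 * t)) * (n * m)) =
      (runs * (18 + 3 * (61 + 15 * t))) * (n ^ 5 * m).
    by rewrite /N [n ^ 5]expnS; ring.
  by move: (N * T) (n ^ 5 * m) => a b; rewrite mulnDr mulnDl; lia.
- rewrite /phi subn0 (_ : update _ _ _ _ _ _ = input I best 0) //.
  (* The factor [n ^ 4] in [N] cancels the one in the denominator of [p], so the bound does not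
     depend on the instance. *)
  have -> : (runs%:R * (check_prob R t / 2) = N%:R * p)%R.
    have : (n%:R != 0 :> R)%R by rewrite pnatr_eq0 -lt0n.
    by rewrite /one_run_prob /N natrM natrX => n_neq0; field.
  have decay := power_decay N (p := p).
  have {}decay : ((1 - p) ^+ N <= (1 + N%:R * p)^-1)%R.
    by apply: decay; rewrite p0 one_run_prob_le1.
  have pos : (0 <= (1 + N%:R * p)^-1)%R by rewrite invr_ge0 addr_ge0 // mulr_ge0.
  case: ifP => // _; first by rewrite gerBl mulr_ge0 ?subr_ge0.
  by rewrite lerD2l lerN2 ler_wpM2l ?subr_ge0.
- by move=> s' _; split => //; rewrite /phi subnn expr0 mulr1 opprB addrCA subrr addr0.
Qed.

End Amplification.

(** * Word size and choice of the constants *)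

Lemma word_bound_large t (I : instance t) runs :
  (nv I * t + 2 * ne I + nv I + t + 24 < word_bound I (t + runs + 31)) /\
  (runs * nv I ^ 4 < word_bound I (t + runs + 31)).
Proof.
rewrite /word_bound; move: (nv I) (ne I) => n m; set B := n + m + 2.
have B2 : 1 < B by rewrite /B; lia.
split.
  (* The left side is at most [B * (t + 26)], and [j < B ^ j] turns the coefficient into an
     exponent. *)
  apply: leq_trans (_ : B * B ^ (t + 26) <= _); last first.
    by rewrite -expnS leq_pexp2l //; lia.
  apply: leq_ltn_trans (_ : _ <= B * (t + 26)) _; first by rewrite /B !mulnDl !mulnDr; lia.
  by have := ltn_expl (t + 26) B2; move: (t + 26) => j; rewrite ltn_pmul2l // ltnW.
apply: leq_trans (_ : B ^ runs * B ^ 4 <= _); last first.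
  by rewrite -expnD leq_pexp2l //; lia.
have le_n : n ^ 4 <= B ^ 4 by rewrite leq_exp2r // /B; lia.
apply: leq_ltn_trans (leq_mul (leqnn runs) le_n) _.
have B4 : 0 < B ^ 4 by rewrite expn_gt0 ltnW.
by have := ltn_expl runs B2; move: (B ^ 4) B4 => B4 B4_gt0; rewrite ltn_pmul2r.
Qed.

Lemma optimal_value_exists t (I : instance t) :
  exists k, is_optimal_value I (if k == 0 then None else Some k).
Proof.
case: (boolP [exists F : {set 'I_(ne I)}, feasible F]) => [/existsP [F0 f0]|]; last first.
  by rewrite negb_exists => H; exists 0.
have [F fF le_F] := arg_minnP (fun F : {set 'I_(ne I)} => #|F|) f0.
exists #|F|; have /feasibleP [F_neq0 _] := fF.
rewrite cards_eq0 (negPf F_neq0) /=; apply/andP; split.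
  by apply/existsP; exists F; rewrite fF eqxx.
by apply/forallP => G; apply/implyP => /le_F.
Qed.

Theorem theorem3p9 (R : realType) (t : nat) (ht : 0 < t)
    (eps : R) (heps : (0 < eps)%R) :
  exists (p : cmd) (c C : nat),
    forall I : instance t,
      solves_within eps p c (C * (nv I ^ 5 * ne I + 1)) I.
Proof.
(* Chosen so that [runs * check_prob * eps] is at least 2, which makes the failure bound
   [1 / (1 + runs * check_prob / 2)] at most [eps]. *)
pose runs := (Num.truncn (2 / (check_prob R t * eps))).+1.
have q_gt0 := check_prob_gt0 R t.
have runsE : (2 <= runs%:R * (check_prob R t * eps))%R.
  by rewrite -ler_pdivrMr ?mulr_gt0 // ltW // truncnS_gt.
exists (even_cut_program t runs), (t + runs + 31),
  (runs * (18 + 3 * (61 + 15 * t)) + 4) => I.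
have [W1 W2] := word_bound_large I runs.
have [k k_opt] := optimal_value_exists I.
split.
  apply/eqP; rewrite eq_le prob_halt_le1 /=.
  (* With full credit for failure, [goal_value] is 1 on every final memory, and only halting is
     measured. *)
  have A01 : (0 <= (1 : R) <= 1)%R by rewrite ler01 lexx.
  have H := program_step W1 W2 k_opt A01.
  rewrite -[X in prob_halt _ _ _ X]addn0.
  apply: le_trans (H _ 0 [::] _); first by rewrite subrr mul0r subr0.
  by move=> s _; rewrite /= /goal_value; case: ifP.
(* With no credit, [goal_value] is the indicator of [best] holding [k], in which case the output is
   optimal. *)
have A01 : (0 <= (0 : R) <= 1)%R by rewrite ler01 lexx.
have H := program_step W1 W2 k_opt A01.
rewrite -[X in prob_halt _ _ _ X]addn0.
apply: le_trans (H _ 0 [::] _); last first.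
  move=> s _ /=; rewrite /goal_value; case: eqP => [sk|_]; last exact: ler0n.
  by rewrite (_ : is_optimal_value _ _) // /output sk; exact: k_opt.
rewrite subr0 mul1r lerD2l lerN2.
have eps_le : (1 <= eps * (1 + runs%:R * (check_prob R t / 2)))%R.
  have -> : (eps * (1 + runs%:R * (check_prob R t / 2)) =
    eps + runs%:R * (check_prob R t * eps) / 2)%R by ring.
  by rewrite -[X in (X <= _)%R]add0r lerD ?(ltW heps) // ler_pdivlMr // mul1r.
by rewrite -[X in (X <= _)%R]mul1r ler_pdivrMr // ltr_wpDr // mulr_ge0 // divr_ge0 // ltW.
Qed.
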